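(* Let $F$ be a finite graph with $v(F)\le e(F)$. Then $F$ is Sidorenko-good if and only if, for every non-zero bounded doubly nonnegative kernel $K$, $$t(F,K)\ge\rho(K)^{2e(F)-v(F)}\,\|K\|_1^{v(F)-e(F)},$$ where $\rho(K)$ denotes the operator norm of $T_K$ on $L^2$.
   Context: All underlying probability spaces $(\Omega,\mu)$ are standard and atomless (so isomorphic to $[0,1]$ with Lebesgue measure). Graphs are finite and simple, with at least one edge; isolated vertices are deleted, so $v(F)$ denotes the number of non-isolated vertices of $F$ and $e(F)$ the number of edges. A bounded doubly nonnegative kernel is a bounded symmetric measurable function $K:\Omega^2\to[0,\infty)$ on such a space with $K\succeq0$, meaning $\int f(x)K(x,y)f(y)\,d\mu(x)\,d\mu(y)\ge0$ for every bounded measurable real-valued $f$ on $\Omega$. Non-zero means not almost everywhere $0$. Write $\|K\|_1=\int_{\Omega^2}K\,d\mu\,d\mu$, $T_Kf(x)=\int_\Omega K(x,y)f(y)\,d\mu(y)$, and $t(F,K)=\int_{\Omega^{V(F)}}\prod_{uv\in E(F)}K(x_u,x_v)\prod_{u\in V(F)}d\mu(x_u)$. $F$ is Sidorenko-good if $t(F,K)\ge\|K\|_1^{e(F)}$ for every bounded doubly nonnegative kernel $K$. *)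

(* Defs.v *)
From HB Require Import structures.
From mathcomp Require Import all_boot all_order all_algebra.
From mathcomp Require Import all_classical all_reals all_analysis.

Set Implicit Arguments.
Unset Strict Implicit.
Unset Printing Implicit Defensive.

Import Order.TTheory GRing.Theory Num.Theory.
Import numFieldNormedType.Exports.

Local Open Scope classical_set_scope.
Local Open Scope ring_scope.

(* The sigma-algebra of T is the Borel sigma-algebra of some Polish topology,
   presented by a complete separable metric space X in bijection with T
   (a Hausdorff pseudometric is a metric). *)
Definition standard_borel (R : realType) (d : measure_display)
    (T : measurableType d) : Prop :=
  exists (X : completePseudoMetricType R) (f : T -> X),
    [/\ hausdorff_space X,
        exists2 D : set X, countable D & dense D,
        bijective f &
        forall A : set T, measurable A <-> <<s [set U : set X | open U] >> (f @` A)].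

Definition atomless (R : realType) (d : measure_display)
    (T : measurableType d) (P : probability T R) : Prop :=
  forall A : set T, measurable A -> (0 < P A)%E ->
    exists B : set T,
      [/\ measurable B, B `<=` A, (0 < P B)%E & (P B < P A)%E].

Definition standard_atomless (R : realType) (d : measure_display)
    (T : measurableType d) (P : probability T R) : Prop :=
  standard_borel R T /\ atomless P.

Section Kernel.
Context (R : realType) (d : measure_display) (T : measurableType d).
Variables (P : probability T R) (K : T * T -> R).

Definition psd_kernel : Prop :=
  forall f : T -> R, measurable_fun setT f -> (exists M, forall x, `|f x| <= M) ->
    0 <= \int[(P \x P)%E]_z (f z.1 * K z * f z.2).

Record bounded_dnn_kernel : Prop := BoundedDnnKernel {
  dnn_measurable : measurable_fun setT K;
  dnn_bounded : exists M, forall z, `|K z| <= M;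
  dnn_symmetric : forall x y, K (x, y) = K (y, x);
  dnn_ge0 : forall z, 0 <= K z;
  dnn_psd : psd_kernel }.

Definition nonzero_kernel : Prop :=
  ~ {ae (P \x P)%E, forall z, K z = 0}.

(* No absolute value: only used for nonnegative kernels. *)
Definition kernel_norm1 : R := \int[(P \x P)%E]_z K z.

Definition kernel_op (f : T -> R) : T -> R :=
  fun x => \int[P]_y (K (x, y) * f y).

(* sup of ||T_K f||_2 over the unit ball of L^2; the set is bounded when K is
   bounded and measurable, so that sup and fine are then meaningful. *)
Definition kernel_opnorm : R :=
  sup [set fine 'N[P]_2%:E[EFin \o kernel_op f]%E | f in
        [set f : T -> R | f \in Lfun P 2%:E /\
                          ('N[P]_2%:E[EFin \o f] <= 1)%E]].

End Kernel.

Section Power.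
Context (R : realType) (d : measure_display) (T : measurableType d).

Definition tuple_cons (n : nat) (z : T * n.-tuple T) : n.+1.-tuple T :=
  [tuple of z.1 :: z.2].

Lemma measurable_tuple_cons n : measurable_fun setT (@tuple_cons n).
Proof. exact: (measurable_cons measurable_fst measurable_snd). Qed.

HB.instance Definition _ n :=
  @isMeasurableFun.Build _ _ _ _ (@tuple_cons n) (@measurable_tuple_cons n).

(* The n-fold product probability on T^n. *)
Fixpoint power_probability (P : probability T R) (n : nat) :
    probability (n.-tuple T) R :=
  match n with
  | 0 => \d_([tuple] : 0.-tuple T)
  | m.+1 => distribution (P \x power_probability P m)%E (@tuple_cons m)
  end.

End Power.

Record simple_graph := SimpleGraph {
  vertex :> finType;
  adj : rel vertex;
  adj_sym : symmetric adj;
  adj_irr : irreflexive adj }.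

(* Each edge is listed once, oriented by the enumeration of the vertices. *)
Definition edges (F : simple_graph) : {set F * F} :=
  [set p : F * F | adj p.1 p.2 && (enum_rank p.1 < enum_rank p.2)%N].

Definition edge_count (F : simple_graph) : nat := #|edges F|.

Definition vertex_count (F : simple_graph) : nat :=
  #|[set u : F | [exists w, adj u w]]|.

(* x_u is the coordinate of index enum_rank u.  Isolated vertices are
   integrated out with factor 1, which amounts to deleting them. *)
Definition hom_density (R : realType) (d : measure_display)
    (T : measurableType d) (P : probability T R) (F : simple_graph)
    (K : T * T -> R) : R :=
  \int[power_probability P #|F|]_x
    \prod_(p in edges F) K (tnth x (enum_rank p.1), tnth x (enum_rank p.2)).

Definition sidorenko_good (R : realType) (F : simple_graph) : Prop :=
  forall (d : measure_display) (T : measurableType d) (P : probability T R)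
    (K : T * T -> R),
  standard_atomless P -> bounded_dnn_kernel P K ->
  kernel_norm1 P K ^+ edge_count F <= hom_density P F K.

(* Main.v *)
From mathcomp Require Import all_boot all_order all_algebra.
From mathcomp Require Import all_classical all_reals all_analysis.
From mathcomp Require Import measurable_realfun.
From mathcomp Require Import ring lra.
Require Import Defs.
Set Implicit Arguments.
Unset Strict Implicit.
Unset Printing Implicit Defensive.
Import Order.TTheory GRing.Theory Num.Theory.
Import numFieldNormedType.Exports.
Local Open Scope classical_set_scope.
Local Open Scope ring_scope.

(** Write t for the density of F in K, S for the L1 norm of K, rho for the
    operator norm, e and v for the numbers of edges and of non-isolated vertices,
    and D = 2e - v.

    One direction only uses S <= rho, seen on the constant function 1: the lower
    bound rho^D S^(v - e) is at least S^D S^(v - e) = S^e.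

    For the other direction, condition the probability measure on a set A of mass
    alpha, and let beta be the integral of K over A x A. Sidorenko's inequality for
    the conditioned measure reads t >= beta^e / alpha^D. This can be written
    t >= (beta / alpha)^D beta^(v - e), and since beta <= S and v <= e it gives
    t >= (beta / alpha)^D S^(v - e): the operator norm appears as soon as it is
    attained on an indicator function. It need not be, but it nearly is for high
    tensor powers. Suppose that K is a finite weighted matrix and g a test
    function. The N-th tensor power of g takes a constant value on each type class
    of words of length N, and there are at most (N + 1)^m classes, where m is the
    number of letters. As K is positive semidefinite, the diagonal terms of the
    decomposition along the classes control the whole quadratic form up to the
    number of classes, so that one of the indicators has a Rayleigh quotient at
    least (N + 1)^(-m) times the N-th power of that of g. Density and norm are
    multiplicative under tensor powers, so taking N-th roots removes the
    polynomial factor ([fin_rayleigh_le]).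

    The finite matrices produced this way are realised as step kernels on the unit
    interval ([sidorenko_good_fin]), where the hypothesis applies. Conversely a
    bounded kernel K is approximated in L1 by its averages over the blocks of a
    finite partition ([exists_step_approximation]). Averaging keeps positivity, the
    L1 norm and the bounds on K; the density is Lipschitz in L1
    ([dist_hom_density_le]), and the operator moves by at most the L2 distance of
    the kernels ([kernel_op_hilbert_schmidt]), so the finite inequality passes to
    the limit ([Rintegral_kernel_op_sqr_le]). *)

(** * Positive semidefinite forms on a finite set *)

Section FiniteForms.
Variables (R : realFieldType) (J : finType).
Implicit Types (a : J -> J -> R) (f g : J -> R).

Definition bilin a f g : R := \sum_i \sum_j f i * a i j * g j.

Definition psd a : Prop := forall f, 0 <= bilin a f f.

Lemma bilin_combination a f g (x : R) :
  bilin a (fun i => f i + x * g i) (fun i => f i + x * g i) =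
  bilin a f f + x * (bilin a f g + bilin a g f) + x ^+ 2 * bilin a g g.
Proof.
rewrite /bilin -big_split /= mulr_sumr mulr_sumr -!big_split /=.
apply: eq_bigr => i _.
rewrite -big_split /= !mulr_sumr -!big_split /=.
by apply: eq_bigr => j _; ring.
Qed.

Lemma bilin_deltal a g i0 :
  bilin a (fun i => (i == i0)%:R) g = \sum_j a i0 j * g j.
Proof.
rewrite /bilin (bigD1 i0) //= eqxx [X in _ + X]big1 ?addr0.
  by apply: eq_bigr => j _; rewrite mul1r.
by move=> i /negPf ->; rewrite big1 // => j _; rewrite !mul0r.
Qed.

Lemma bilin_deltar a f j0 :
  bilin a f (fun j => (j == j0)%:R) = \sum_i f i * a i j0.
Proof.
apply: eq_bigr => i _; rewrite (bigD1 j0) //= eqxx mulr1 big1 ?addr0 //.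
by move=> j /negPf ->; rewrite mulr0.
Qed.

Lemma psd_diag_ge0 a i : psd a -> 0 <= a i i.
Proof.
move/(_ (fun j => (j == i)%:R)); rewrite bilin_deltal (bigD1 i) //= eqxx mulr1.
by rewrite big1 ?addr0 // => j /negPf ->; rewrite mulr0.
Qed.

Lemma psd_diag_eq0 a : psd a -> (forall i j, a i j = a j i) ->
  (forall i, a i i = 0) -> forall i j, a i j = 0.
Proof.
move=> pa sa a0 i j.
(* at e_j - x e_i, with x = a i j, the form equals - 2 x^2 *)
have /= := pa (fun k => (k == j)%:R + (- a i j) * (k == i)%:R).
rewrite bilin_combination !bilin_deltal.
have E k l : \sum_m a k m * (m == l)%:R = a k l.
  rewrite (bigD1 l) //= eqxx mulr1 big1 ?addr0 // => m /negPf ->.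
  by rewrite mulr0.
rewrite !E !a0 (sa j i) mulr0 addr0 add0r => h.
apply/eqP; rewrite -sqrf_eq0 eq_le sqr_ge0 andbT expr2; lra.
Qed.

(** Subtracting the rank one form carried by a nonzero diagonal entry keeps
    positivity: the new form at f is the old one at f moved along the
    corresponding basis vector. *)
Lemma psd_gram a : psd a -> (forall i j, a i j = a j i) ->
  exists n (c : 'I_n -> R) (b : 'I_n -> J -> R), (forall l, 0 <= c l) /\
    forall i j, a i j = \sum_l c l * b l i * b l j.
Proof.
have [m] := ubnP #|[pred i | a i i != 0]|.
elim: m a => // m IH a lem pa sa.
have [/existsP [k ak]|] := boolP [exists k, a k k != 0]; last first.
  rewrite negb_exists => /forallP a0.
  exists 0, (fun=> 0), (fun _ _ => 0); split=> // i j.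
  rewrite big_ord0; apply: psd_diag_eq0 => // l.
  by apply/eqP; rewrite -[_ == _]negbK a0.
have ak0 : 0 < a k k by rewrite lt_def ak psd_diag_ge0.
(* the Schur complement of the entry (k, k) *)
pose a' i j := a i j - (a k k)^-1 * a k i * a k j.
have pa' : psd a'.
  move=> f; pose s := \sum_j a k j * f j.
  have /= := pa (fun i => f i + (- (a k k)^-1 * s) * (i == k)%:R).
  rewrite bilin_combination !bilin_deltal bilin_deltar.
  have -> : \sum_i f i * a i k = s.
    by apply: eq_bigr => i _; rewrite sa mulrC.
  have -> : \sum_j a k j * (j == k)%:R = a k k.
    rewrite (bigD1 k) //= eqxx mulr1 big1 ?addr0 // => j /negPf ->.
    by rewrite mulr0.
  have -> : bilin a' f f = bilin a f f - (a k k)^-1 * s ^+ 2.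
    rewrite /bilin expr2 {1}/s mulr_suml mulr_sumr -sumrB.
    apply: eq_bigr => i _; rewrite /s !mulr_sumr -sumrB.
    by apply: eq_bigr => j _; rewrite /a'; ring.
  rewrite -/s; congr (0 <= _); field; exact: ak.
have sa' i j : a' i j = a' j i by rewrite /a' (sa i j); ring.
have [|//|//|n [c [b [c0 ab]]]] := IH a'.
  rewrite ltnS in lem; apply: leq_trans lem.
  apply: proper_card; apply/properP; split; last first.
    by exists k; rewrite !inE ?ak // /a' mulVf // mul1r subrr eqxx.
  apply/fintype.subsetP => i; rewrite !inE; apply: contraNN => /eqP ai0.
  have aki : a k i = 0.
    (* when a i i = 0, the entry of a' at (i, i) is - a k i ^+ 2 / a k k *)
    have := pa' (fun j => (j == i)%:R); rewrite bilin_deltal (bigD1 i) //= eqxx.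
    rewrite big1 ?addr0; last by move=> j /negPf ->; rewrite mulr0.
    rewrite /a' ai0 sub0r mulr1 -mulrA -expr2 oppr_ge0 => h.
    have : a k i ^+ 2 <= 0 by rewrite -(pmulr_rle0 _ (_ : 0 < (a k k)^-1)) ?invr_gt0.
    by rewrite exprn_even_le0 //= => /eqP.
  by rewrite /a' ai0 aki !mulr0 subrr.
exists n.+1, (fun l => if unlift ord0 l is Some l' then c l' else (a k k)^-1),
  (fun l => if unlift ord0 l is Some l' then b l' else a k); split.
  by move=> l; case: unliftP => [l' _|_] //; rewrite invr_ge0 ltW.
move=> i j; rewrite big_ord_recl unlift_none.
under eq_bigr do rewrite liftK.
by rewrite -ab /a' addrC subrK.
Qed.

Lemma sqr_sum_le (I : finType) (z : I -> R) :
  (\sum_i z i) ^+ 2 <= #|I|%:R * \sum_i z i ^+ 2.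
Proof.
have : 0 <= \sum_i \sum_j (z i - z j) ^+ 2.
  by apply: sumr_ge0 => i _; apply: sumr_ge0 => j _; exact: sqr_ge0.
have -> : \sum_i \sum_j (z i - z j) ^+ 2 =
    2 * (#|I|%:R * \sum_i z i ^+ 2) - 2 * (\sum_i z i) ^+ 2.
  have sc (c : R) : \sum_(i : I) c = #|I|%:R * c by rewrite sumr_const mulr_natl.
  pose s := \sum_i z i; pose q := \sum_i z i ^+ 2; rewrite -/s -/q.
  transitivity (\sum_i (#|I|%:R * z i ^+ 2 + q - 2 * z i * s)).
    apply: eq_bigr => i _.
    under eq_bigr do rewrite sqrrB.
    rewrite big_split /= sumrB sc -/q sumrMnl -mulr_sumr -/s.
    by rewrite -[_ *+ 2]mulr_natl; ring.
  rewrite sumrB big_split /= -mulr_sumr -mulr_suml -mulr_sumr -/s -/q.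
  by rewrite sc; ring.
lra.
Qed.

(** A positive form is a sum of squares, so it inherits the Cauchy-Schwarz bound
    on the square of a sum. *)
Lemma psd_sum_le (I : finType) a (u : I -> J -> R) :
  psd a -> (forall i j, a i j = a j i) ->
  bilin a (fun j => \sum_k u k j) (fun j => \sum_k u k j) <=
  #|I|%:R * \sum_k bilin a (u k) (u k).
Proof.
move=> pa sa; have [n [c [b [c0 ab]]]] := psd_gram pa sa.
have E f : bilin a f f = \sum_l c l * (\sum_i b l i * f i) ^+ 2.
  rewrite /bilin; under eq_bigr do under eq_bigr do
    rewrite ab mulr_sumr mulr_suml.
  under eq_bigr do rewrite exchange_big /=.
  rewrite exchange_big; apply: eq_bigr => l _ /=.
  rewrite expr2 big_distrlr /= mulr_sumr; apply: eq_bigr => i _.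
  by rewrite mulr_sumr; apply: eq_bigr => j _; ring.
rewrite E; under [X in _ <= _ * X]eq_bigr do rewrite E.
rewrite exchange_big mulr_sumr /=; apply: ler_sum => l _.
rewrite -mulr_sumr [leRHS]mulrCA; apply: ler_wpM2l => //.
under eq_bigr do rewrite mulr_sumr.
by rewrite exchange_big; exact: sqr_sum_le.
Qed.

End FiniteForms.

(** * Finite homomorphism densities and restriction to a set *)

Definition non_isolated (F : simple_graph) (u : F) : bool := [exists w, adj u w].

Section FiniteDensity.
Variables (R : realFieldType) (F : simple_graph) (J : finType).
Implicit Types (a : J -> J -> R) (w : F -> J -> R) (p : J -> R).

Definition edge_weight a (x : {ffun F -> J}) : R :=
  \prod_(q in edges F) a (x q.1) (x q.2).

Definition fin_density w a : R :=
  \sum_(x : {ffun F -> J}) (\prod_u w u (x u)) * edge_weight a x.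

Lemma edge_non_isolated (q : F * F) :
  q \in edges F -> non_isolated q.1 && non_isolated q.2.
Proof.
rewrite inE => /andP[q12 _]; apply/andP; split; apply/existsP.
  by exists q.2.
by exists q.1; rewrite adj_sym.
Qed.

Lemma edge_weight_ge0 a x : (forall i j, 0 <= a i j) -> 0 <= edge_weight a x.
Proof. by move=> a0; apply: prodr_ge0. Qed.

Lemma fin_density_ge0 w a : (forall i j, 0 <= a i j) ->
  (forall u i, 0 <= w u i) -> 0 <= fin_density w a.
Proof.
move=> a0 w0; apply: sumr_ge0 => x _; apply: mulr_ge0.
  exact: prodr_ge0.
exact: edge_weight_ge0.
Qed.

Lemma sum_prod_eq1 w : (forall u, \sum_j w u j = 1) ->
  \sum_(x : {ffun F -> J}) \prod_u w u (x u) = 1.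
Proof. by move=> w1; rewrite -bigA_distr_bigA big1. Qed.

(** Draw a second independent assignment from the other law; exchanging the two
    assignments on isolated vertices turns one sum into the other, because the
    edges do not see those vertices. *)
Lemma fin_density_isolated w w' a :
  (forall u, \sum_j w u j = 1) -> (forall u, \sum_j w' u j = 1) ->
  (forall u, non_isolated u -> w u = w' u) -> fin_density w a = fin_density w' a.
Proof.
move=> w1 w'1 ww'.
pose mix (z : {ffun F -> J} * {ffun F -> J}) : {ffun F -> J} :=
  [ffun u => if non_isolated u then z.1 u else z.2 u].
pose swap z := (mix z, mix (z.2, z.1)).
have swapK : involutive swap.
  move=> [x y]; rewrite /swap /mix /=.
  by congr (_, _); apply/ffunP => u; rewrite !ffunE /= ?ffunE; case: (non_isolated u).
have E (v v' : F -> J -> R) : (forall u, \sum_j v' u j = 1) ->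
    fin_density v a = \sum_(z : {ffun F -> J} * {ffun F -> J})
      (\prod_u (v u (z.1 u) * v' u (z.2 u))) * edge_weight a z.1.
  move=> v'1; rewrite -(pair_bigA _ (fun x y : {ffun F -> J} =>
    (\prod_u (v u (x u) * v' u (y u))) * edge_weight a x)) /=.
  apply: eq_bigr => x _; rewrite -mulr_suml.
  under [X in _ = X * _]eq_bigr do rewrite big_split /=.
  by rewrite -mulr_sumr sum_prod_eq1 // mulr1.
rewrite (E w w') // (E w' w) // (reindex_inj (inv_inj swapK)) /=.
apply: eq_bigr => -[x y] _ /=; congr (_ * _).
  apply: eq_bigr => u _; rewrite !ffunE /=; case: ifP => [/ww' -> //|_].
  by rewrite mulrC.
apply: eq_bigr => q /edge_non_isolated /andP[q1 q2].
by rewrite !ffunE q1 q2.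
Qed.

Definition fin_dnn a : Prop :=
  [/\ forall i j, 0 <= a i j, forall i j, a i j = a j i & psd a].

Definition fin_prob p : Prop := (forall i, 0 <= p i) /\ \sum_i p i = 1.

End FiniteDensity.

Definition fin_sidorenko (R : realFieldType) (F : simple_graph) : Prop :=
  forall (J : finType) (p : J -> R) (a : J -> J -> R),
    fin_prob p -> fin_dnn a ->
    bilin a p p ^+ edge_count F <= fin_density (fun _ : F => p) a.

Section Restriction.
Variables (R : realFieldType) (F : simple_graph).
Hypothesis Fgood : fin_sidorenko R F.
Hypothesis e_gt0 : (0 < edge_count F)%N.
Hypothesis le_ve : (vertex_count F <= edge_count F)%N.

(** Sidorenko's inequality for the law conditioned on A, with the normalisation
    cleared; isolated vertices keep their original law so that they do not
    contribute powers of the mass of A. *)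
Lemma fin_sidorenko_restrict (J : finType) (p : J -> R) (a : J -> J -> R)
    (A : pred J) (pA := fun i => if A i then p i else 0) :
  fin_prob p -> fin_dnn a ->
  bilin a pA pA ^+ edge_count F <=
  fin_density (fun _ : F => p) a *
    (\sum_i pA i) ^+ ((edge_count F).*2 - vertex_count F).
Proof.
move=> [p0 p1] [a0 sa pa]; set alpha := \sum_i pA i.
have pA0 i : 0 <= pA i by rewrite /pA; case: ifP.
have pAp i : pA i <= p i by rewrite /pA; case: ifP.
have alpha_ge0 : 0 <= alpha by apply: sumr_ge0.
have [alpha0|alpha_neq0] := eqVneq alpha 0.
  have pA00 i : pA i = 0.
    apply/eqP; move/eqP: alpha0; rewrite psumr_eq0 // => /allP/(_ i); apply.
    by rewrite mem_index_enum.
  rewrite (_ : bilin a pA pA = 0) ?expr0n ?eqn0Ngt ?e_gt0 /=; last first.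
    by rewrite /bilin big1 // => i _; rewrite big1 // => j _; rewrite pA00 !mul0r.
  by rewrite mulr_ge0 ?exprn_ge0 // fin_density_ge0.
have alpha_gt0 : 0 < alpha by rewrite lt_def alpha_neq0.
pose q i := pA i / alpha.
have q_prob : fin_prob q.
  split=> [i|]; first by rewrite divr_ge0.
  by rewrite -mulr_suml divff.
pose w (u : F) := if non_isolated u then q else p.
have le_w : fin_density w a * alpha ^+ vertex_count F <=
    fin_density (fun _ : F => p) a.
  rewrite /fin_density mulr_suml. apply: ler_sum => x _.
  rewrite mulrAC; apply: ler_wpM2r; first exact: edge_weight_ge0.
  have -> : alpha ^+ vertex_count F =
      \prod_(u : F) (if non_isolated u then alpha else 1).
    rewrite -big_mkcond /= prodr_const; congr (_ ^+ _).
    rewrite /vertex_count; apply: eq_card => u; apply/idP/idP => [/set_mem|h] //.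
    exact: (@mem_set _ [set u : F | non_isolated u] u h).
  rewrite -big_split /=; apply: ler_prod => u _; rewrite /w.
  case: ifP => _; last by rewrite mulr1 p0 lexx.
  by rewrite /q divfK // pA0 pAp.
have -> : bilin a pA pA = bilin a q q * alpha ^+ 2.
  rewrite /bilin mulr_suml; apply: eq_bigr => i _.
  by rewrite mulr_suml; apply: eq_bigr => j _; rewrite /q; field.
rewrite exprMn -exprM mul2n.
have le_v2e : (vertex_count F <= (edge_count F).*2)%N.
  by rewrite (leq_trans le_ve) // -addnn leq_addr.
rewrite -{1}(subnKC le_v2e) exprD mulrA.
apply: ler_wpM2r; first exact: exprn_ge0.
apply: le_trans le_w; apply: ler_wpM2r; first exact: exprn_ge0.
rewrite (@fin_density_isolated _ _ _ w (fun _ : F => q)).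
- exact: Fgood.
- by move=> u; rewrite /w; case: ifP; case: q_prob.
- by move=> u; case: q_prob.
- by move=> u; rewrite /w => ->.
Qed.

End Restriction.

(** * Tensor powers and the finite operator inequality *)

Section TensorPower.
Variables (R : realFieldType) (I : finType) (N : nat).
Implicit Types (a : I -> I -> R) (f g p : I -> R).

Local Notation word := {ffun 'I_N -> I}.

Definition tensor_fun f (x : word) : R := \prod_k f (x k).

Definition tensor_kernel a (x y : word) : R := \prod_k a (x k) (y k).

Lemma sum_tensor_fun f : \sum_x tensor_fun f x = (\sum_i f i) ^+ N.
Proof. by rewrite /tensor_fun -(bigA_distr_bigA (fun _ => f)) prodr_const card_ord. Qed.

Lemma bilin_tensor a f g :
  bilin (tensor_kernel a) (tensor_fun f) (tensor_fun g) = bilin a f g ^+ N.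
Proof.
rewrite -[N in RHS]card_ord -prodr_const.
rewrite bigA_distr_bigA; apply: eq_bigr => x _.
rewrite bigA_distr_bigA; apply: eq_bigr => y _.
by rewrite -!big_split.
Qed.

(** The Gram vectors of a tensor power are the products of Gram vectors. *)
Lemma psd_tensor a : psd a -> (forall i j, a i j = a j i) ->
  psd (tensor_kernel a).
Proof.
move=> pa sa f; have [n [c [b [c0 ab]]]] := psd_gram pa sa.
pose cN (L : {ffun 'I_N -> 'I_n}) := \prod_k c (L k).
pose bN (L : {ffun 'I_N -> 'I_n}) (x : word) := \prod_k b (L k) (x k).
have E x y : tensor_kernel a x y = \sum_L cN L * bN L x * bN L y.
  rewrite /tensor_kernel; under eq_bigr do rewrite ab.
  by rewrite bigA_distr_bigA; apply: eq_bigr => L _; rewrite !big_split.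
have -> : bilin (tensor_kernel a) f f =
    \sum_L cN L * (\sum_x bN L x * f x) ^+ 2.
  rewrite /bilin; under eq_bigr do under eq_bigr do
    rewrite E mulr_sumr mulr_suml.
  under eq_bigr do rewrite exchange_big /=.
  rewrite exchange_big; apply: eq_bigr => L _ /=.
  rewrite expr2 big_distrlr /= mulr_sumr; apply: eq_bigr => x _.
  by rewrite mulr_sumr; apply: eq_bigr => y _; ring.
apply: sumr_ge0 => L _; apply: mulr_ge0; last exact: sqr_ge0.
exact: prodr_ge0.
Qed.

Lemma fin_dnn_tensor a : fin_dnn a -> fin_dnn (tensor_kernel a).
Proof.
case=> a0 sa pa; split; last exact: psd_tensor.
  by move=> x y; apply: prodr_ge0.
by move=> x y; apply: eq_bigr => k _.
Qed.

Lemma fin_prob_tensor p : fin_prob p -> fin_prob (tensor_fun p).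
Proof.
case=> p0 p1; split=> [x|]; first exact: prodr_ge0.
by rewrite sum_tensor_fun p1 expr1n.
Qed.

(** A map from the vertices to words is a word of maps to letters, and all
    weights multiply letter by letter. *)
Lemma fin_density_tensor (F : simple_graph) p a :
  fin_density (fun _ : F => tensor_fun p) (tensor_kernel a) =
  fin_density (fun _ : F => p) a ^+ N.
Proof.
pose flip (Y : {ffun 'I_N -> {ffun F -> I}}) : {ffun F -> word} :=
  [ffun u => [ffun k => Y k u]].
pose unflip (X : {ffun F -> word}) : {ffun 'I_N -> {ffun F -> I}} :=
  [ffun k => [ffun u => X u k]].
have flipK : cancel unflip flip.
  by move=> X; apply/ffunP => u; apply/ffunP => k; rewrite !ffunE.
have unflipK : cancel flip unflip.
  by move=> X; apply/ffunP => u; apply/ffunP => k; rewrite !ffunE.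
rewrite -[N in RHS]card_ord -prodr_const bigA_distr_bigA.
rewrite /fin_density (reindex flip) /=; last by exists unflip => ? _.
apply: eq_bigr => Y _; rewrite big_split /= /tensor_fun /edge_weight.
rewrite exchange_big /= [X in _ * X]exchange_big /=.
congr (_ * _); apply: eq_bigr => k _; apply: eq_bigr => q _;
  by rewrite !ffunE.
Qed.

(** A tensor power of a function is constant on the classes of this type, and
    there are only polynomially many classes. *)
Definition word_type (x : word) : {ffun I -> 'I_N.+1} :=
  [ffun i => inord #|[pred k | x k == i]|].

Lemma tensor_fun_type g (x : word) :
  tensor_fun g x = \prod_i g i ^+ word_type x i.
Proof.
rewrite /tensor_fun (partition_big x xpredT) //=.
apply: eq_bigr => i _; rewrite ffunE inordK; last first.
  by rewrite ltnS -[leqRHS]card_ord max_card.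
by rewrite -prodr_const; apply: eq_bigr => k /eqP ->.
Qed.

Lemma card_word_type : #|{ffun I -> 'I_N.+1}| = (N.+1 ^ #|I|)%N.
Proof. by rewrite card_ffun card_ord. Qed.

End TensorPower.

Section FiniteInequality.
Variables (R : archiRealFieldType) (F : simple_graph).

(** Otherwise the ratio x / y exceeds 1 + d with d > 0, and Bernoulli's
    inequality raised to the power m + 1 outgrows a polynomial of degree m. *)
Lemma le_exprn_poly (m : nat) (x y : R) : 0 <= y ->
  (forall N, x ^+ N <= (N.+1 ^ m)%:R * y ^+ N) -> x <= y.
Proof.
move=> y0 h; rewrite leNgt; apply/negP => yx.
have [y_eq0|y_neq0] := eqVneq y 0.
  have := h 1; rewrite !expr1 y_eq0 mulr0 leNgt -{1}y_eq0 yx //.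
have y_gt0 : 0 < y by rewrite lt_def y_neq0.
pose d := Num.min 1 (x / y - 1).
have d_gt0 : 0 < d by rewrite lt_min ltr01 subr_gt0 ltr_pdivlMr // mul1r.
have d_le1 : d <= 1 by rewrite ge_min lexx.
have d_le : 1 + d <= x / y by rewrite -lerBrDl ge_min lexx orbT.
have hz N : (1 + d) ^+ N <= (N.+1 ^ m)%:R.
  apply: (@le_trans _ _ ((x / y) ^+ N)).
    by apply: lerXn2r; rewrite ?nnegrE //; lra.
  by rewrite expr_div_n ler_pdivrMr ?exprn_gt0.
have bern M : 1 + M%:R * d <= (1 + d) ^+ M.
  elim: M => [|M IH]; first by rewrite mul0r addr0.
  rewrite exprS; apply: (@le_trans _ _ ((1 + d) * (1 + M%:R * d))); last first.
    by apply: ler_wpM2l => //; lra.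
  rewrite -natr1 -subr_ge0.
  rewrite (_ : _ - _ = M%:R * d ^+ 2); last by ring.
  by rewrite mulr_ge0 ?sqr_ge0.
(* beyond C, (d (M + 1))^(m + 1) exceeds ((m + 1) (M + 1))^m *)
pose C : R := (m.+1 ^ m)%:R / d ^+ m.+1.
have [M CM] : exists M : nat, C < M%:R.
  by exists (Num.truncn C).+1; exact: truncnS_gt.
have Md0 : 0 <= M%:R * d by rewrite mulr_ge0 // ltW.
have := hz (M * m.+1)%N; apply/negP; rewrite -ltNge exprM.
apply: (@lt_le_trans _ _ ((1 + M%:R * d) ^+ m.+1)); last first.
  by apply: lerXn2r; rewrite ?nnegrE ?exprn_ge0 ?bern //; lra.
apply: (@lt_le_trans _ _ ((d * M.+1%:R) ^+ m.+1)); last first.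
  apply: lerXn2r; rewrite ?nnegrE; [by rewrite mulr_ge0 // ltW|lra|].
  by rewrite -natr1 mulrDr mulr1 mulrC addrC lerD2r.
apply: (@le_lt_trans _ _ ((m.+1 * M.+1) ^ m)%:R).
  rewrite natrX [leRHS]natrX; apply: lerXn2r; rewrite ?nnegrE ?ler0n // ler_nat.
  by rewrite [leqRHS]mulnS [(M * _)%N]mulnC addSn ltnS leq_addl.
rewrite expnMn natrM exprMn; set u : R := M.+1%:R.
have u_gt0 : 0 < u by rewrite ltr0n.
rewrite [(M.+1 ^ m)%:R]natrX -/u [u ^+ m.+1]exprS mulrA.
rewrite ltr_pM2r ?exprn_gt0 // mulrC -ltr_pdivrMr ?exprn_gt0 //.
by apply: lt_trans CM _; rewrite ltr_nat.
Qed.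

(** Cut the N-th tensor power of p g along the type classes: by positivity the
    diagonal blocks dominate up to the number of classes. On a class of mass
    alpha carrying the form value beta, the restricted Sidorenko inequality
    reads beta^e <= t^N alpha^D; multiplying it by beta^(e - v) <= S^(N (e - v)),
    which is where v <= e matters, gives beta <= r^N alpha. Summing over the
    classes and letting N grow removes the polynomial factor. *)
Lemma fin_rayleigh_le (I : finType) (p : I -> R) (a : I -> I -> R)
    (g : I -> R) (r : R)
    (D := ((edge_count F).*2 - vertex_count F)%N) :
  fin_sidorenko R F -> (0 < edge_count F)%N ->
  (vertex_count F <= edge_count F)%N ->
  fin_prob p -> fin_dnn a -> 0 <= r ->
  fin_density (fun _ : F => p) a *
    bilin a p p ^+ (edge_count F - vertex_count F) <= r ^+ D ->
  bilin a (fun i => p i * g i) (fun i => p i * g i) <=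
    r * \sum_i p i * g i ^+ 2.
Proof.
move=> Fgood e_gt0 le_ve p_prob a_dnn r0 hr.
have [p0 p1] := p_prob; have [a0 sa pa] := a_dnn.
pose nrm := \sum_i p i * g i ^+ 2.
have nrm0 : 0 <= nrm by apply: sumr_ge0 => i _; rewrite mulr_ge0 ?sqr_ge0.
apply: (@le_exprn_poly #|I|); first exact: mulr_ge0.
move=> N; set Q := bilin a _ _; rewrite -card_word_type.
pose P := @tensor_fun R I N p; pose A := @tensor_kernel R I N a.
pose G := @tensor_fun R I N g.
have P_prob : fin_prob P by exact: fin_prob_tensor.
have A_dnn : fin_dnn A by exact: fin_dnn_tensor.
have [P0 P1] := P_prob; have [A0 sA pA] := A_dnn.
pose cl t (x : {ffun 'I_N -> I}) := word_type x == t.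
pose Pt t x := if cl t x then P x else 0.
pose c (t : {ffun I -> 'I_N.+1}) := \prod_i g i ^+ t i.
pose u t x := c t * Pt t x.
have PGE x : P x * G x = \sum_t u t x.
  rewrite (bigD1 (word_type x)) //= big1 ?addr0; last first.
    by move=> t /negPf h; rewrite /u /Pt /cl eq_sym h mulr0.
  by rewrite /u /Pt /cl eqxx mulrC /G tensor_fun_type.
have -> : Q ^+ N = bilin A (fun x => P x * G x) (fun x => P x * G x).
  rewrite /Q -bilin_tensor /bilin; apply: eq_bigr => x _; apply: eq_bigr => y _.
  by rewrite /tensor_fun !big_split.
have -> : bilin A (fun x => P x * G x) (fun x => P x * G x) =
    bilin A (fun x => \sum_t u t x) (fun x => \sum_t u t x).
  by apply: eq_bigr => x _; apply: eq_bigr => y _; rewrite !PGE.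
apply: le_trans (psd_sum_le u pA sA) _; apply: ler_wpM2l; first exact: ler0n.
have Pt0 t x : 0 <= Pt t x by rewrite /Pt; case: ifP.
have PtP t x : Pt t x <= P x by rewrite /Pt; case: ifP.
have beta_le t : bilin A (Pt t) (Pt t) <= r ^+ N * \sum_x Pt t x.
  set beta := bilin _ _ _; set alpha := \sum_x _.
  have alpha0 : 0 <= alpha by apply: sumr_ge0.
  have beta0 : 0 <= beta by exact: pA.
  have D_gt0 : (0 < D)%N.
    by rewrite subn_gt0 -addnn (leq_ltn_trans le_ve) // -ltn_subLR // subnn.
  have betaS : beta <= bilin a p p ^+ N.
    rewrite -bilin_tensor; apply: ler_sum => x _; apply: ler_sum => y _.
    by apply: ler_pM; rewrite ?mulr_ge0 //; apply: ler_wpM2r.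
  rewrite -(ler_pXn2r D_gt0) ?nnegrE ?mulr_ge0 ?exprn_ge0 //.
  have DE : D = (edge_count F + (edge_count F - vertex_count F))%N.
    by rewrite /D -addnn addnBA.
  rewrite [X in beta ^+ X]DE exprD.
  apply: (@le_trans _ _ (fin_density (fun _ : F => P) A *
      alpha ^+ D * (bilin a p p ^+ N) ^+ (edge_count F - vertex_count F))).
    apply: ler_pM; rewrite ?exprn_ge0 //.
      exact: (fin_sidorenko_restrict Fgood e_gt0 le_ve (cl t) P_prob A_dnn).
    by apply: lerXn2r; rewrite ?nnegrE ?exprn_ge0 //; exact: pa.
  rewrite exprMn mulrAC; apply: ler_wpM2r.
    exact: exprn_ge0.
  rewrite fin_density_tensor -!exprM mulnC [(N * D)%N]mulnC !exprM -exprMn.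
  by apply: lerXn2r; rewrite ?nnegrE ?mulr_ge0 ?exprn_ge0 ?fin_density_ge0 ?pa.
rewrite exprMn.
have -> : nrm ^+ N = \sum_t \sum_x c t ^+ 2 * Pt t x.
  rewrite -sum_tensor_fun exchange_big; apply: eq_bigr => x _ /=.
  rewrite (bigD1 (word_type x)) //= big1 ?addr0; last first.
    by move=> t /negPf h; rewrite /Pt /cl eq_sym h mulr0.
  rewrite /Pt /cl eqxx /c -tensor_fun_type /tensor_fun big_split /= mulrC.
  by rewrite prodrXl.
rewrite mulr_sumr; apply: ler_sum => t _.
rewrite -mulr_sumr mulrCA.
have -> : bilin A (u t) (u t) = c t ^+ 2 * bilin A (Pt t) (Pt t).
  rewrite /bilin mulr_sumr; apply: eq_bigr => x _.
  by rewrite mulr_sumr; apply: eq_bigr => y _; rewrite /u; ring.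
by apply: ler_wpM2l; [exact: sqr_ge0|exact: beta_le].
Qed.

End FiniteInequality.

(** * Integrals of bounded measurable functions *)

Section BoundedMeasurable.
Context {R : realType}.

Definition bounded_measurable d (T : measurableType d) (f : T -> R) : Prop :=
  measurable_fun setT f /\ exists M, forall x, `|f x| <= M.

Lemma bounded_measurable_cst d (T : measurableType d) (c : R) :
  bounded_measurable (fun _ : T => c).
Proof. by split; [exact: measurable_cst|exists `|c|]. Qed.

Lemma bounded_measurableD d (T : measurableType d) (f g : T -> R) :
  bounded_measurable f -> bounded_measurable g ->
  bounded_measurable (fun x => f x + g x).
Proof.
move=> [mf [M fM]] [mg [M' gM]]; split; first exact: measurable_funD.
by exists (M + M') => x; rewrite (le_trans (ler_normD _ _)) // lerD.
Qed.

Lemma bounded_measurableM d (T : measurableType d) (f g : T -> R) :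
  bounded_measurable f -> bounded_measurable g ->
  bounded_measurable (fun x => f x * g x).
Proof.
move=> [mf [M fM]] [mg [M' gM]]; split; first exact: measurable_funM.
by exists (M * M') => x; rewrite normrM ler_pM.
Qed.

Lemma bounded_measurableB d (T : measurableType d) (f g : T -> R) :
  bounded_measurable f -> bounded_measurable g ->
  bounded_measurable (fun x => f x - g x).
Proof.
move=> [mf [M fM]] [mg [M' gM]]; split; first exact: measurable_funB.
by exists (M + M') => x; rewrite (le_trans (ler_normB _ _)) // lerD.
Qed.

Lemma bounded_measurable_norm d (T : measurableType d) (f : T -> R) :
  bounded_measurable f -> bounded_measurable (fun x => `|f x|).
Proof.
move=> [mf [M fM]]; split; first exact: measurableT_comp.
by exists M => x; rewrite normr_id.
Qed.

Lemma bounded_measurable_sum d (T : measurableType d) (I : Type) (s : seq I)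
    (P : pred I) (f : I -> T -> R) :
  (forall i, P i -> bounded_measurable (f i)) ->
  bounded_measurable (fun x => \sum_(i <- s | P i) f i x).
Proof.
move=> bf; elim: s => [|i s IH].
  have -> : (fun x => \sum_(i <- [::] | P i) f i x) = (fun=> 0).
    by apply/funext => x; rewrite big_nil.
  exact: bounded_measurable_cst.
have -> : (fun x => \sum_(j <- i :: s | P j) f j x) =
    (fun x => if P i then f i x + \sum_(j <- s | P j) f j x
              else \sum_(j <- s | P j) f j x).
  by apply/funext => x; rewrite big_cons.
by case Pi : (P i) => //; apply: bounded_measurableD => //; exact: bf.
Qed.

Lemma bounded_measurable_prod d (T : measurableType d) (I : Type) (s : seq I)
    (P : pred I) (f : I -> T -> R) :
  (forall i, P i -> bounded_measurable (f i)) ->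
  bounded_measurable (fun x => \prod_(i <- s | P i) f i x).
Proof.
move=> bf; elim: s => [|i s IH].
  have -> : (fun x => \prod_(i <- [::] | P i) f i x) = (fun=> 1).
    by apply/funext => x; rewrite big_nil.
  exact: bounded_measurable_cst.
have -> : (fun x => \prod_(j <- i :: s | P j) f j x) =
    (fun x => if P i then f i x * \prod_(j <- s | P j) f j x
              else \prod_(j <- s | P j) f j x).
  by apply/funext => x; rewrite big_cons.
by case Pi : (P i) => //; apply: bounded_measurableM => //; exact: bf.
Qed.

Lemma bounded_measurable_comp d d' (T : measurableType d)
    (T' : measurableType d') (f : T -> R) (g : T' -> T) :
  measurable_fun setT g -> bounded_measurable f -> bounded_measurable (f \o g).
Proof.
by move=> mg [mf [M fM]]; split; [exact: measurableT_comp|exists M => x /=].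
Qed.

Section Integral.
Context d (T : measurableType d) (P : probability T R).
Implicit Types f g : T -> R.

Lemma bounded_measurable_integrable f :
  bounded_measurable f -> P.-integrable setT (EFin \o f).
Proof.
move=> [mf [M fM]]; apply: measurable_bounded_integrable => //.
  by apply: (le_lt_trans (probability_le1 P measurableT)); rewrite ltry.
exists M; split; first by rewrite num_real.
by move=> x Mx y _ /=; rewrite (le_trans (fM y)) // ltW.
Qed.

Lemma integrable_mul_bounded h f : bounded_measurable h ->
  P.-integrable setT (EFin \o f) -> P.-integrable setT (EFin \o (fun x => h x * f x)).
Proof.
move=> [mh [M hM]] fi.
apply: (integrableMr measurableT mh _ fi).
exists M; split; first by rewrite num_real.
by move=> x Mx y _ /=; rewrite (le_trans (hM y)) // ltW.
Qed.

Lemma EFin_Rintegral f : P.-integrable setT (EFin \o f) ->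
  (\int[P]_x f x)%:E = (\int[P]_x (f x)%:E)%E.
Proof. by move=> /integrable_fin_num h; rewrite /Rintegral fineK // h. Qed.

Lemma Rintegral_sum (I : Type) (s : seq I) (Q : pred I) (f : I -> T -> R) :
  (forall i, P.-integrable setT (EFin \o f i)) ->
  \int[P]_x (\sum_(i <- s | Q i) f i x) =
  \sum_(i <- s | Q i) \int[P]_x f i x.
Proof.
move=> fi; apply: EFin_inj; rewrite EFin_Rintegral; last first.
  rewrite (_ : _ \o _ = fun x => (\sum_(i <- s | Q i) (f i x)%:E)%E).
    by apply: integrable_sum => // i _; exact: fi.
  by apply/funext => x /=; rewrite sumEFin.
under eq_integral do rewrite -sumEFin.
rewrite integral_sum //.
by rewrite -sumEFin; apply: eq_bigr => i _; rewrite EFin_Rintegral.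
Qed.

Lemma Rintegral_scale c f : bounded_measurable f ->
  \int[P]_x (c * f x) = c * \int[P]_x f x.
Proof. by move=> /bounded_measurable_integrable ?; rewrite RintegralZl. Qed.

Lemma Rintegral_const c : \int[P]_x c = c.
Proof.
by rewrite Rintegral_cst // [X in fine X](probability_setT P) mulr1.
Qed.

Lemma Rintegral_mono f g : bounded_measurable f -> bounded_measurable g ->
  (forall x, f x <= g x) -> \int[P]_x f x <= \int[P]_x g x.
Proof.
move=> bf bg fg; apply: le_Rintegral => //; exact: bounded_measurable_integrable.
Qed.

Lemma Rintegral_norm_le f M : bounded_measurable f ->
  (forall x, `|f x| <= M) -> `|\int[P]_x f x| <= M.
Proof.
move=> bf fM; have bi := bounded_measurable_integrable bf.
apply: le_trans (le_normr_Rintegral measurableT bi) _.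
rewrite -[leRHS]Rintegral_const; apply: Rintegral_mono => //.
  exact: bounded_measurable_norm.
exact: bounded_measurable_cst.
Qed.

Lemma Rintegral_indic (A : set T) : measurable A ->
  \int[P]_x (\1_A x) = fine (P A).
Proof. by move=> mA; rewrite /Rintegral integral_indic // setIT. Qed.

End Integral.

Section Fubini.
Context d1 d2 (T1 : measurableType d1) (T2 : measurableType d2).
Variables (P1 : probability T1 R) (P2 : probability T2 R).

Lemma bounded_measurable_section (f : T1 * T2 -> R) x :
  bounded_measurable f -> bounded_measurable (fun y => f (x, y)).
Proof.
by move=> bf; apply: (bounded_measurable_comp _ bf); exact: pair1_measurable.
Qed.

Lemma bounded_measurable_inner (f : T1 * T2 -> R) :
  bounded_measurable f -> bounded_measurable (fun x => \int[P2]_y f (x, y)).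
Proof.
move=> bf; have [_ [M fM]] := bf; split; last first.
  by exists M => x; apply: Rintegral_norm_le => //;
    exact: bounded_measurable_section.
apply/measurable_EFinP.
have -> : EFin \o (fun x => \int[P2]_y f (x, y)) = fubini_F P2 (EFin \o f).
  apply/funext => x /=; rewrite EFin_Rintegral //.
  by apply: bounded_measurable_integrable; exact: bounded_measurable_section.
apply: (@measurable_fubini_F _ _ _ _ _ P1).
exact: bounded_measurable_integrable.
Qed.

Lemma Rintegral_fubini (f : T1 * T2 -> R) : bounded_measurable f ->
  \int[(P1 \x P2)%E]_z f z = \int[P1]_x \int[P2]_y f (x, y).
Proof.
move=> bf; have fi := bounded_measurable_integrable (P1 \x P2)%E bf.
apply: EFin_inj; rewrite (EFin_Rintegral fi).
rewrite EFin_Rintegral; last first.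
  by apply: bounded_measurable_integrable; exact: bounded_measurable_inner.
rewrite -integral12_prod_meas1 //; apply: eq_integral => x _.
rewrite EFin_Rintegral //; apply: bounded_measurable_integrable.
exact: bounded_measurable_section.
Qed.

End Fubini.
End BoundedMeasurable.

(** * Step kernels *)

Section FiniteValued.
Context {R : realType} d (T : measurableType d) (P : probability T R).
Variables (J : finType) (psi : T -> J).

Definition fibers_measurable : Prop := forall j, measurable (psi @^-1` [set j]).

Hypothesis mpsi : fibers_measurable.

Definition fiber_ind (j : J) (x : T) : R := (psi x == j)%:R.

Definition law (j : J) : R := \int[P]_x fiber_ind j x.

Lemma fiber_indE j : fiber_ind j = \1_(psi @^-1` [set j]).
Proof.
apply/funext => x; rewrite indicE /fiber_ind; congr (nat_of_bool _)%:R.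
by apply/eqP/idP => [/mem_set|/set_mem].
Qed.

Lemma bounded_measurable_fiber_ind j : bounded_measurable (fiber_ind j).
Proof.
split; first by rewrite fiber_indE; exact: measurable_indic.
by exists 1 => x; rewrite /fiber_ind; case: eqP; rewrite ?normr0 ?normr1.
Qed.

Lemma fiber_ind_sum (h : J -> R) x : \sum_j h j * fiber_ind j x = h (psi x).
Proof.
rewrite (bigD1 (psi x)) //= /fiber_ind eqxx mulr1 big1 ?addr0 // => j.
by rewrite eq_sym => /negPf ->; rewrite mulr0.
Qed.

Lemma bounded_measurable_finite (h : J -> R) :
  bounded_measurable (fun x => h (psi x)).
Proof.
have -> : (fun x => h (psi x)) = (fun x => \sum_j h j * fiber_ind j x).
  by apply/funext => x; rewrite fiber_ind_sum.
apply: bounded_measurable_sum => j _; apply: bounded_measurableM.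
  exact: bounded_measurable_cst.
exact: bounded_measurable_fiber_ind.
Qed.

Lemma Rintegral_fibers (h : J -> R) (f : T -> R) :
  P.-integrable setT (EFin \o f) ->
  \int[P]_x (h (psi x) * f x) = \sum_j h j * \int[P]_x (fiber_ind j x * f x).
Proof.
move=> fi.
have bi j := integrable_mul_bounded (bounded_measurable_fiber_ind j) fi.
under eq_Rintegral do rewrite -fiber_ind_sum mulr_suml.
rewrite Rintegral_sum; last first.
  move=> j; apply: integrable_mul_bounded => //; apply: bounded_measurableM.
    exact: bounded_measurable_cst.
  exact: bounded_measurable_fiber_ind.
apply: eq_bigr => j _; rewrite -RintegralZl //.
by under [RHS]eq_Rintegral do rewrite mulrA.
Qed.

Lemma Rintegral_finite (h : J -> R) :
  \int[P]_x h (psi x) = \sum_j h j * law j.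
Proof.
have b1 := bounded_measurable_cst T (1 : R).
have := Rintegral_fibers h (bounded_measurable_integrable P b1).
under eq_Rintegral do rewrite mulr1.
move=> ->; apply: eq_bigr => j _.
by under eq_Rintegral do rewrite mulr1.
Qed.

Lemma law_ge0 j : 0 <= law j.
Proof. by apply: Rintegral_ge0 => x _; exact: ler0n. Qed.

Lemma law_prob : fin_prob law.
Proof.
split; first exact: law_ge0.
have := Rintegral_finite (fun=> 1); rewrite Rintegral_const => ->.
by apply: eq_bigr => j _; rewrite mul1r.
Qed.

End FiniteValued.

Section ProductFormulas.
Context {R : realType}.

Lemma Rintegral_prod2 d1 d2 (T1 : measurableType d1) (T2 : measurableType d2)
    (P1 : probability T1 R) (P2 : probability T2 R) (f : T1 -> R) (g : T2 -> R) :
  bounded_measurable f -> bounded_measurable g ->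
  \int[(P1 \x P2)%E]_z (f z.1 * g z.2) = (\int[P1]_x f x) * \int[P2]_y g y.
Proof.
move=> bf bg; rewrite Rintegral_fubini /=; last first.
  apply: bounded_measurableM.
    exact: (bounded_measurable_comp measurable_fst bf).
  exact: (bounded_measurable_comp measurable_snd bg).
under eq_Rintegral do rewrite Rintegral_scale //.
under eq_Rintegral do rewrite mulrC.
by rewrite Rintegral_scale // mulrC.
Qed.

Context d (T : measurableType d) (P : probability T R).

Lemma bounded_measurable_tnth n (k : 'I_n) (f : T -> R) :
  bounded_measurable f ->
  bounded_measurable (fun x : n.-tuple T => f (tnth x k)).
Proof. by move=> bf; apply: (bounded_measurable_comp (measurable_tnth k) bf). Qed.

(** The first coordinate is independent of the remaining ones. *)
Lemma Rintegral_powerS n (G : n.+1.-tuple T -> R) : bounded_measurable G ->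
  \int[power_probability P n.+1]_x G x =
  \int[P]_z \int[power_probability P n]_x G [tuple of z :: x].
Proof.
move=> bG; rewrite -(Rintegral_fubini P (power_probability P n)
  (bounded_measurable_comp (@measurable_tuple_cons d T n) bG)).
apply: EFin_inj; rewrite !EFin_Rintegral; last 2 first.
- apply: bounded_measurable_integrable.
  exact: (bounded_measurable_comp (@measurable_tuple_cons d T n) bG).
- exact: bounded_measurable_integrable.
rewrite /= /distribution integral_pushforward //.
- by apply/measurable_EFinP; case: bG.
- apply: (@bounded_measurable_integrable _ _ _ (P \x power_probability P n)%E).
  exact: (bounded_measurable_comp (@measurable_tuple_cons d T n) bG).
Qed.

Lemma Rintegral_power_prod n (f : 'I_n -> T -> R) :
  (forall k, bounded_measurable (f k)) ->
  \int[power_probability P n]_x \prod_k f k (tnth x k) =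
  \prod_k \int[P]_x f k x.
Proof.
elim: n f => [|n IH] f bf.
  under eq_Rintegral do rewrite big_ord0.
  by rewrite Rintegral_const big_ord0.
rewrite Rintegral_powerS; last first.
  by apply: bounded_measurable_prod => k _; exact: bounded_measurable_tnth.
under eq_Rintegral => z _.
  under eq_Rintegral => x _.
    rewrite big_ord_recl tnth0; under eq_bigr do rewrite tnthS.
    over.
  rewrite Rintegral_scale; last first.
    by apply: bounded_measurable_prod => k _; exact: bounded_measurable_tnth.
  rewrite (IH (fun k => f (lift ord0 k))) // mulrC.
  over.
by rewrite Rintegral_scale // big_ord_recl mulrC.
Qed.

Lemma Rintegral_power_tnth n (k : 'I_n) (f : T -> R) : bounded_measurable f ->
  \int[power_probability P n]_x f (tnth x k) = \int[P]_x f x.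
Proof.
move=> bf; pose g i := if i == k then f else fun=> 1.
have bg i : bounded_measurable (g i).
  by rewrite /g; case: ifP => // _; exact: bounded_measurable_cst.
transitivity (\int[power_probability P n]_x \prod_i g i (tnth x i)).
  apply: eq_Rintegral => x _; rewrite (bigD1 k) //= /g eqxx big1 ?mulr1 //.
  by move=> i /negPf ->.
rewrite Rintegral_power_prod // (bigD1 k) //= big1 ?mulr1 /g ?eqxx //.
by move=> i /negPf ->; rewrite Rintegral_const.
Qed.

Lemma Rintegral_power_tnth2 n (i j : 'I_n) (g : T * T -> R) :
  (i < j)%N -> bounded_measurable g ->
  \int[power_probability P n]_x g (tnth x i, tnth x j) =
  \int[(P \x P)%E]_z g z.
Proof.
move=> ij bg; elim: n i j ij => [[]//|n IH] i j ij.
rewrite Rintegral_powerS; last first.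
  apply: (bounded_measurable_comp _ bg).
  by apply: measurable_fun_pair; exact: measurable_tnth.
have [j' jE] : exists j', j = lift ord0 j'.
  by case: (unliftP ord0 j) ij => [j' -> _|->]; [exists j'|rewrite ltn0].
rewrite {}jE in ij *; case: (unliftP ord0 i) ij => [i' ->|->] ij.
  rewrite -[RHS](Rintegral_const P); apply: eq_Rintegral => z _.
  under eq_Rintegral do rewrite !tnthS.
  exact: IH.
rewrite Rintegral_fubini //; apply: eq_Rintegral => z _.
under eq_Rintegral do rewrite tnth0 tnthS.
by rewrite (Rintegral_power_tnth _ (f := fun y => g (z, y))) //;
  exact: bounded_measurable_section.
Qed.

End ProductFormulas.

Section StepKernel.
Context {R : realType} d (T : measurableType d) (P : probability T R).
Variables (J : finType) (psi : T -> J) (mpsi : fibers_measurable psi).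
Local Notation p := (law P psi).

Definition step_kernel (a : J -> J -> R) (z : T * T) : R := a (psi z.1) (psi z.2).

Definition pair_map (z : T * T) : J * J := (psi z.1, psi z.2).

Lemma fibers_measurable_pair : fibers_measurable pair_map.
Proof.
move=> [i j].
rewrite (_ : _ @^-1` _ = (psi @^-1` [set i]) `*` (psi @^-1` [set j])).
  exact: measurableX.
by apply/seteqP; split=> -[x y] /= [<- <-].
Qed.

Lemma fiber_ind_pair (ij : J * J) (z : T * T) :
  fiber_ind pair_map ij z = fiber_ind psi ij.1 z.1 * fiber_ind psi ij.2 z.2 :> R.
Proof.
by case: ij => i j; rewrite /fiber_ind /pair_map xpair_eqE -natrM mulnb.
Qed.

Lemma bounded_measurable_step a : bounded_measurable (step_kernel a).
Proof.
exact: (bounded_measurable_finite fibers_measurable_pair (fun ij => a ij.1 ij.2)).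
Qed.

Lemma Rintegral_step (a : J -> J -> R) (f g : T -> R) :
  bounded_measurable f -> bounded_measurable g ->
  \int[(P \x P)%E]_z (f z.1 * step_kernel a z * g z.2) =
  bilin a (fun i => \int[P]_x (fiber_ind psi i x * f x))
          (fun j => \int[P]_x (fiber_ind psi j x * g x)).
Proof.
move=> bf bg; rewrite /bilin pair_bigA /=.
have bfg : bounded_measurable (fun z : T * T => f z.1 * g z.2).
  apply: bounded_measurableM.
    exact: (bounded_measurable_comp measurable_fst bf).
  exact: (bounded_measurable_comp measurable_snd bg).
pose h (ij : J * J) := a ij.1 ij.2.
transitivity (\int[(P \x P)%E]_z (h (pair_map z) * (f z.1 * g z.2))).
  by apply: eq_Rintegral => z _; rewrite /step_kernel /h /=; ring.
rewrite (Rintegral_fibers fibers_measurable_pair h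
  (bounded_measurable_integrable (P \x P)%E bfg)).
apply: eq_bigr => -[i j] _ /=.
transitivity (h (i, j) * \int[(P \x P)%E]_z
    ((fiber_ind psi i z.1 * f z.1) * (fiber_ind psi j z.2 * g z.2))).
  by congr (_ * _); apply: eq_Rintegral => z _; rewrite fiber_ind_pair /=; ring.
rewrite (Rintegral_prod2 P P (f := fun x => fiber_ind psi i x * f x)
  (g := fun x => fiber_ind psi j x * g x)).
- by rewrite /h /=; ring.
- by apply: bounded_measurableM => //; exact: bounded_measurable_fiber_ind.
- by apply: bounded_measurableM => //; exact: bounded_measurable_fiber_ind.
Qed.

Lemma kernel_norm1_step a : kernel_norm1 P (step_kernel a) = bilin a p p.
Proof.
have b1 := bounded_measurable_cst T (1 : R).
transitivity (\int[(P \x P)%E]_z (1 * step_kernel a z * 1)).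
  by apply: eq_Rintegral => z _; rewrite mul1r mulr1.
rewrite (Rintegral_step a b1 b1); apply: eq_bigr => i _; apply: eq_bigr => j _.
by congr (_ * _ * _); apply: eq_Rintegral => x _; rewrite mulr1.
Qed.

Lemma bounded_dnn_step a : fin_dnn a -> bounded_dnn_kernel P (step_kernel a).
Proof.
move=> [a0 sa pa]; have [mK bK] := bounded_measurable_step a; split=> //.
- by move=> x y; exact: sa.
- by move=> z; exact: a0.
- by move=> f mf bf; rewrite Rintegral_step //; exact: pa.
Qed.

(** The labels of the coordinates are independent with the law of psi, and a
    step kernel sees only the labels. *)
Lemma hom_density_step (F : simple_graph) a :
  hom_density P F (step_kernel a) = fin_density (fun _ : F => p) a.
Proof.
rewrite /hom_density.
transitivity (\int[power_probability P #|F|]_x \sum_(y : {ffun F -> J})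
   edge_weight a y * \prod_u fiber_ind psi (y u) (tnth x (enum_rank u))).
  apply: eq_Rintegral => x _.
  pose y : {ffun F -> J} := [ffun u => psi (tnth x (enum_rank u))].
  rewrite (bigD1 y) //= [X in _ * X]big1 ?mulr1; last first.
    by move=> u _; rewrite /fiber_ind ffunE eqxx.
  rewrite [X in _ + X]big1 ?addr0; last first.
    move=> y' y'y.
    have [u hu] : exists u, y' u != y u.
      apply/existsP; apply: contraNT y'y; rewrite negb_exists => /forallP h.
      by apply/eqP/ffunP => u; apply/eqP; rewrite -[_ == _]negbK.
    rewrite (bigD1 u) //= /fiber_ind; move: hu; rewrite ffunE eq_sym => /negPf ->.
    by rewrite mul0r mulr0.
  by apply: eq_bigr => q _; rewrite /step_kernel !ffunE.
have bfi (y : {ffun F -> J}) : bounded_measurable (fun x : #|F|.-tuple T =>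
    \prod_u (fiber_ind psi (y u) (tnth x (enum_rank u)) : R)).
  apply: bounded_measurable_prod => u _.
  by apply: bounded_measurable_tnth; exact: bounded_measurable_fiber_ind.
rewrite Rintegral_sum; last first.
  move=> y; apply: bounded_measurable_integrable.
  by apply: bounded_measurableM => //; exact: bounded_measurable_cst.
apply: eq_bigr => y _; rewrite Rintegral_scale // mulrC; congr (_ * _).
have bij : {on xpredT, bijective (@enum_val F F)}.
  by exists enum_rank => k _; rewrite ?enum_valK ?enum_rankK.
pose f (k : 'I_#|F|) : T -> R := fiber_ind psi (y (enum_val k)).
transitivity (\int[power_probability P #|F|]_x \prod_k f k (tnth x k)).
  apply: eq_Rintegral => x _; rewrite (reindex _ bij).
  by apply: eq_bigr => k _; rewrite /f enum_valK.
rewrite Rintegral_power_prod; last by move=> k; exact: bounded_measurable_fiber_ind.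
by rewrite [RHS](reindex _ bij).
Qed.

End StepKernel.

(** * Realising finite laws on the unit interval *)

Section UnitInterval.
Context (R : realType).

Definition unit_prob : probability (measurableTypeR R) R :=
  uniform_prob (@ltr01 R).

Lemma standard_borel_real : standard_borel R (measurableTypeR R).
Proof.
exists R, idfun; split.
- exact: Rhausdorff.
- exists (range (@ratr R)); last exact: dense_rat.
  by apply: card_le_trans (card_image_le _ _) _; exact: countableP.
- by exists idfun.
- move=> A; rewrite image_id; split; last first.
    apply: smallest_sub; first exact: sigma_algebra_measurable.
    by move=> U; exact: open_measurable.
  rewrite [measurable _](_ : _ = <<s @RGenOpens.G R >> A); last first.
    by rewrite -[LHS]/((ocitv (R:=R)).-sigma.-measurable A) RGenOpens.measurableE.
  apply: sub_sigma_algebra2 => _ [x [y ->]].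
  exact: interval_open.
Qed.

Lemma unit_prob_itv (a b : R) : 0 <= a -> a <= b -> b <= 1 ->
  unit_prob `[a, b[%classic = (b - a)%:E.
Proof.
move=> a0 ab b1; rewrite /unit_prob /= /uniform_prob.
rewrite (eq_integral (fun=> 1%E)); last first.
  move=> x; rewrite inE /= in_itv /= => /andP[ax xb].
  by rewrite /uniform_pdf (le_trans a0 ax) (ltW (lt_le_trans xb b1)) /= subr0 invr1.
rewrite integral_cst //= mul1e lebesgue_measure_itv /= lte_fin.
by case: ltgtP ab => // -> _; rewrite subrr.
Qed.

Lemma unit_prob_ge1 : unit_prob `[1, +oo[%classic = 0%E.
Proof.
have h : unit_prob (~` `[0, 1[%classic) = 0%E.
  by rewrite probability_setC // unit_prob_itv // subr0 subee.
apply/eqP; rewrite eq_le measure_ge0 andbT -h; apply: le_measure; rewrite ?inE //.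
  exact: measurableC.
move=> x /=; rewrite !in_itv /= andbT => x1.
by apply/negP; rewrite negb_and -!leNgt x1 orbT.
Qed.

Section Cut.
Variables (J : finType) (p : J -> R) (j0 : J).

(** Each letter j owns an interval of length p j, laid end to end from c on; the
    value j0 is taken beyond the last one. *)
Fixpoint cut (s : seq J) (c : R) (x : R) : J :=
  if s is j :: s' then if x < c + p j then j else cut s' (c + p j) x else j0.

Lemma preimage_cut_cons h s c j : cut (h :: s) c @^-1` [set j] =
  (if h == j then `]-oo, c + p h[%classic else set0) `|`
  (`[c + p h, +oo[%classic `&` cut s (c + p h) @^-1` [set j]).
Proof.
apply/seteqP; split=> x /=.
  case: ltP => xc; last by move=> ?; right; rewrite in_itv /= andbT.
  by move=> <-; left; rewrite eqxx /= in_itv.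
case: ltP => xc; last first.
  by case=> [|[]//]; case: eqP => // _ /=; rewrite in_itv /= ltNge xc.
by case=> [|[]]; [case: eqP => //|rewrite in_itv /= andbT leNgt xc].
Qed.

Lemma measurable_cut s c j :
  measurable (cut s c @^-1` [set j] : set (measurableTypeR R)).
Proof.
elim: s c => [|h s IH] c.
  have [j0j|/eqP jj0] := eqVneq j0 j.
    rewrite (_ : _ @^-1` _ = setT); first exact: measurableT.
    by apply/seteqP; split.
  rewrite (_ : _ @^-1` _ = set0); first exact: measurable0.
  by apply/seteqP; split=> x //= /jj0.
rewrite preimage_cut_cons; apply: measurableU.
  by case: ifP => _; [exact: measurable_itv|exact: measurable0].
by apply: measurableI; [exact: measurable_itv|exact: IH].
Qed.

Lemma unit_prob_cut s c j : (forall i, 0 <= p i) -> uniq s -> 0 <= c ->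
  c + \sum_(i <- s) p i = 1 ->
  unit_prob (`[c, +oo[%classic `&` cut s c @^-1` [set j]) =
  ((j \in s)%:R * p j)%:E.
Proof.
move=> p0; elim: s c => [|h s IH] c.
  rewrite big_nil addr0 => _ _ ->; rewrite mul0r.
  apply/eqP; rewrite eq_le measure_ge0 andbT.
  apply: (@le_trans _ _ (unit_prob `[1, +oo[%classic)); last first.
    by rewrite unit_prob_ge1.
  apply: le_measure; last exact: subIsetl; apply: mem_set.
    by apply: measurableI; [exact: measurable_itv|exact: measurable_cut].
  exact: measurable_itv.
rewrite cons_uniq => /andP[hs us] c0; rewrite big_cons addrA => c1.
have chc : c <= c + p h by rewrite lerDl.
have ch0 : 0 <= c + p h by rewrite addr_ge0.
have ch1 : c + p h <= 1 by rewrite -c1 lerDl sumr_ge0.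
rewrite preimage_cut_cons setIUr measureU /=; last 3 first.
- apply: measurableI; first exact: measurable_itv.
  by case: ifP => _; [exact: measurable_itv|exact: measurable0].
- apply: measurableI; first exact: measurable_itv.
  by apply: measurableI; [exact: measurable_itv|exact: measurable_cut].
- apply/seteqP; split=> // x /= [[_ h1] [_ [h2 _]]]; move: h1 h2.
  by case: ifP => // _ /=; rewrite !in_itv /= andbT leNgt => ->.
rewrite [X in (_ + X)%E](_ : _ = unit_prob (`[c + p h, +oo[%classic `&`
    cut s (c + p h) @^-1` [set j])); last first.
  congr (unit_prob _); apply/seteqP; split=> x /=; first by case.
  case=> h1 h2; split=> //; move: h1; rewrite !in_itv /= !andbT.
  exact: le_trans.
rewrite IH // inE [j == h]eq_sym; case: eqVneq => [<-|_] /=; last first.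
  by rewrite setI0 measure0 add0e.
rewrite (negPf hs) mul0r adde0 mul1r.
rewrite (_ : _ `&` _ = `[c, c + p h[%classic).
  by rewrite unit_prob_itv // addrAC subrr add0r.
by apply/seteqP; split=> x /=; rewrite !in_itv /= andbT; [case=> -> ->|case/andP=> -> ->].
Qed.

End Cut.

(** Consecutive intervals of prescribed lengths realise any finite law on the
    unit interval. *)
Lemma realize_law (J : finType) (p : J -> R) : fin_prob p ->
  exists psi : measurableTypeR R -> J,
    fibers_measurable psi /\ law unit_prob psi = p.
Proof.
move=> [p0 p1].
have [j0 _] : exists j0 : J, true.
  apply/existsP; apply: contraT => /existsPn h.
  have := p1; rewrite big1 => [/eqP|j _]; first by rewrite eq_sym oner_eq0.
  by have := h j.
pose psi : measurableTypeR R -> J := cut p j0 (index_enum J) 0.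
have mpsi : fibers_measurable psi by move=> j; exact: measurable_cut.
exists psi; split=> //; apply/funext => j.
(* both laws have total mass 1, so one inequality for each letter suffices *)
have ple i : p i <= law unit_prob psi i.
  rewrite /law fiber_indE Rintegral_indic; last exact: mpsi.
  rewrite -lee_fin fineK ?fin_num_measure //.
  have <- : unit_prob (`[0, +oo[%classic `&` psi @^-1` [set i]) = (p i)%:E.
    rewrite unit_prob_cut ?mem_index_enum ?mul1r ?add0r //.
    exact: index_enum_uniq.
  apply: le_measure; last exact: subIsetr; apply: mem_set; last exact: mpsi.
  by apply: measurableI; [exact: measurable_itv|exact: mpsi].
apply/eqP; rewrite -subr_eq0; apply/eqP.
have [_ l1] := law_prob unit_prob mpsi.
have : \sum_i (law unit_prob psi i - p i) == 0.
  by rewrite sumrB l1 p1 subrr.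
rewrite psumr_eq0 => [/allP/(_ j)|i _]; last by rewrite subr_ge0.
by rewrite mem_index_enum => /(_ isT)/eqP.
Qed.

(** Split the line into classes of equal mass less than that of A: one of them
    meets A in a set of positive but smaller measure. *)
Lemma atomless_unit_prob : atomless unit_prob.
Proof.
move=> A mA A_gt0.
have PA : unit_prob A \is a fin_num by rewrite fin_num_measure.
have [n nA] : exists n : nat, ((n.+1%:R^-1)%:E < unit_prob A)%E.
  exists (Num.truncn (fine (unit_prob A))^-1).
  rewrite -(fineK PA) lte_fin -[ltRHS]invrK ltf_pV2 ?posrE ?ltr0n ?invr_gt0 //.
    exact: truncnS_gt.
  by rewrite fine_gt0 // A_gt0 ltey_eq PA.
have [|psi [mpsi lawE]] := @realize_law 'I_n.+1 (fun=> n.+1%:R^-1).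
  split=> [i|]; first by rewrite invr_ge0.
  by rewrite sumr_const card_ord -[_ *+ _]mulr_natl divff // pnatr_eq0.
have mB k : measurable (A `&` psi @^-1` [set k]) by apply: measurableI.
have [k Bk] : exists k, (0 < unit_prob (A `&` psi @^-1` [set k]))%E.
  apply: contrapT => /forallNP h; move: A_gt0; apply/negP; rewrite -leNgt.
  rewrite -(fineK PA) lee_fin -Rintegral_indic //.
  under eq_Rintegral do rewrite -[\1_A _]mul1r.
  have bA : bounded_measurable (\1_A : measurableTypeR R -> R).
    split; first exact: measurable_indic.
    by exists 1 => x; rewrite indicE; case: (_ \in _); rewrite ?normr0 ?normr1.
  rewrite (Rintegral_fibers mpsi (fun=> 1)
    (bounded_measurable_integrable unit_prob bA)) big1 // => k _.
  rewrite mul1r fiber_indE.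
  rewrite (@eq_Rintegral _ _ _ _ _ (\1_(A `&` psi @^-1` [set k]))); last first.
    by move=> x _; rewrite indicI /= mulrC.
  rewrite Rintegral_indic // (_ : unit_prob _ = 0%E) //.
  by apply/eqP; rewrite eq_le measure_ge0 andbT leNgt; apply/negP.
exists (A `&` psi @^-1` [set k]); split=> //.
apply: le_lt_trans nA; have <- := congr1 (@^~ k) lawE.
rewrite /law fiber_indE Rintegral_indic ?fineK ?fin_num_measure //.
by apply: le_measure; last exact: subIsetr; apply: mem_set => //; exact: mpsi.
Qed.

(** A finite weighted kernel is a step kernel on the unit interval. *)
Lemma sidorenko_good_fin (F : simple_graph) : sidorenko_good R F -> fin_sidorenko R F.
Proof.
move=> Fgood J p a p_prob a_dnn.
have [psi [mpsi <-]] := realize_law p_prob.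
rewrite -kernel_norm1_step // -hom_density_step //.
apply: Fgood; last exact: bounded_dnn_step.
by split; [exact: standard_borel_real|exact: atomless_unit_prob].
Qed.

End UnitInterval.

(** * Approximation by step kernels *)

Section StepApproximation.
Context {R : realType} d (T : measurableType d) (P : probability T R).
Local Notation PP := (P \x P)%E.

Definition step_approximable (f : T * T -> R) : Prop :=
  bounded_measurable f /\
  forall eps : R, 0 < eps -> exists (J : finType) (psi : T -> J) (a : J -> J -> R),
    fibers_measurable psi /\ \int[PP]_z `|f z - step_kernel psi a z| <= eps.

Lemma bounded_measurable_indic d' (T' : measurableType d') (A : set T') :
  measurable A -> bounded_measurable (\1_A : T' -> R).
Proof.
move=> mA; split; first exact: measurable_indic.
by exists 1 => x; rewrite indicE; case: (_ \in _); rewrite ?normr0 ?normr1.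
Qed.

Lemma Rintegral_dist_triangle d' (T' : measurableType d')
    (Q : probability T' R) (f g h : T' -> R) :
  bounded_measurable f -> bounded_measurable g -> bounded_measurable h ->
  \int[Q]_z `|f z - h z| <= \int[Q]_z `|f z - g z| + \int[Q]_z `|g z - h z|.
Proof.
move=> bf bg bh.
have b1 : bounded_measurable (fun z => `|f z - g z|).
  by apply: bounded_measurable_norm; exact: bounded_measurableB.
have b2 : bounded_measurable (fun z => `|g z - h z|).
  by apply: bounded_measurable_norm; exact: bounded_measurableB.
rewrite -RintegralD //; try exact: bounded_measurable_integrable.
apply: Rintegral_mono.
- by apply: bounded_measurable_norm; exact: bounded_measurableB.
- exact: bounded_measurableD.
- by move=> z; exact: ler_distD.
Qed.

Lemma step_approximable_cst c : step_approximable (fun=> c).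
Proof.
split; first exact: bounded_measurable_cst.
move=> eps eps0; exists unit, (fun=> tt), (fun _ _ => c); split.
  by move=> [] ; rewrite (_ : _ @^-1` _ = setT) //; apply/seteqP; split.
under eq_Rintegral do rewrite subrr normr0.
by rewrite Rintegral_const ltW.
Qed.

(** The common refinement of two finite partitions carries both step kernels. *)
Lemma step_approximable_lin f g c : step_approximable f -> step_approximable g ->
  step_approximable (fun z => f z + c * g z).
Proof.
move=> [bf hf] [bg hg].
have bcg : bounded_measurable (fun z => c * g z).
  by apply: bounded_measurableM => //; exact: bounded_measurable_cst.
split; first exact: bounded_measurableD.
move=> eps eps0.
have e2 : 0 < eps / 2 by rewrite divr_gt0.
(* the summand 1 keeps the denominator positive when c = 0 *)
have e3 : 0 < eps / 2 / (`|c| + 1) by rewrite divr_gt0 // ltr_wpDl.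
have [J1 [psi1 [a1 [m1 h1]]]] := hf _ e2.
have [J2 [psi2 [a2 [m2 h2]]]] := hg _ e3.
exists (J1 * J2)%type, (fun x => (psi1 x, psi2 x)),
  (fun i j => a1 i.1 j.1 + c * a2 i.2 j.2); split.
  move=> [i j]; rewrite (_ : _ @^-1` _ =
      psi1 @^-1` [set i] `&` psi2 @^-1` [set j]); first exact: measurableI.
  by apply/seteqP; split=> x /= [<- <-].
have b1 := bounded_measurable_step m1 a1.
have b2 := bounded_measurable_step m2 a2.
have bd1 : bounded_measurable (fun z => `|f z - step_kernel psi1 a1 z|).
  by apply: bounded_measurable_norm; exact: bounded_measurableB.
have bd2 : bounded_measurable (fun z => `|g z - step_kernel psi2 a2 z|).
  by apply: bounded_measurable_norm; exact: bounded_measurableB.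
have bd2c : bounded_measurable
    (fun z => `|c| * `|g z - step_kernel psi2 a2 z|).
  by apply: bounded_measurableM => //; exact: bounded_measurable_cst.
apply: (@le_trans _ _ (\int[PP]_z (`|f z - step_kernel psi1 a1 z| +
    `|c| * `|g z - step_kernel psi2 a2 z|))).
  apply: Rintegral_mono.
  - apply: bounded_measurable_norm; apply: bounded_measurableB.
      exact: bounded_measurableD.
    apply: bounded_measurableD => //; apply: bounded_measurableM => //.
    exact: bounded_measurable_cst.
  - exact: bounded_measurableD.
  - move=> z; rewrite -normrM; apply: le_trans (ler_normD _ _).
    by rewrite le_eqVlt; apply/orP; left; apply/eqP; congr `|_|;
      rewrite /step_kernel /=; ring.
rewrite RintegralD //; try exact: bounded_measurable_integrable.
rewrite Rintegral_scale // [leRHS]splitr lerD //.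
apply: le_trans (_ : (`|c| + 1) * (eps / 2 / (`|c| + 1)) <= _).
  by apply: ler_pM => //; [exact: Rintegral_ge0|rewrite lerDl].
by rewrite mulrC divfK // gt_eqF // ltr_wpDl.
Qed.

Lemma step_approximable_limit f : bounded_measurable f ->
  (forall eps : R, 0 < eps ->
    exists2 g, step_approximable g & \int[PP]_z `|f z - g z| <= eps) ->
  step_approximable f.
Proof.
move=> bf hf; split=> // eps eps0.
have e2 : 0 < eps / 2 by rewrite divr_gt0.
have [g [bg hg] fg] := hf _ e2.
have [J [psi [a [mpsi h]]]] := hg _ e2.
exists J, psi, a; split=> //; rewrite [leRHS]splitr.
apply: le_trans (lerD fg h); apply: Rintegral_dist_triangle => //.
exact: bounded_measurable_step.
Qed.

Lemma step_approximable_sum (I : Type) (s : seq I) (f : I -> T * T -> R) :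
  (forall i, step_approximable (f i)) ->
  step_approximable (fun z => \sum_(i <- s) f i z).
Proof.
move=> hf; elim: s => [|i s IH].
  rewrite (_ : (fun z => _) = fun=> 0); first exact: step_approximable_cst.
  by apply/funext => z; rewrite big_nil.
rewrite (_ : (fun z => _) = (fun z => f i z + 1 * \sum_(j <- s) f j z)).
  exact: step_approximable_lin.
by apply/funext => z; rewrite big_cons mul1r.
Qed.

Lemma step_approximable_rectangle (A B : set T) : measurable A -> measurable B ->
  step_approximable \1_(A `*` B).
Proof.
move=> mA mB; split.
  by apply: bounded_measurable_indic; exact: measurableX.
move=> eps eps0.
exists (bool * bool)%type, (fun x => (x \in A, x \in B)),
  (fun i j => (i.1 && j.2)%:R); split.
  have mm (C : set T) (b : bool) : measurable C ->
      measurable [set x | (x \in C) = b].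
    move=> mC; case: b.
      rewrite (_ : [set x | _] = C) //.
      by apply/seteqP; split=> x /=; [exact: set_mem|exact: mem_set].
    rewrite (_ : [set x | _] = ~` C); first exact: measurableC.
    apply/seteqP; split=> x /=; first by move=> /negbT; rewrite notin_setE.
    by move=> h; apply/negbTE; rewrite notin_setE.
  move=> [i j]; rewrite (_ : _ @^-1` _ =
      [set x | (x \in A) = i] `&` [set x | (x \in B) = j]).
    by apply: measurableI; exact: mm.
  by apply/seteqP; split=> x /= [-> ->].
rewrite (_ : (fun z => _) = fun=> 0) ?Rintegral_const ?ltW //.
apply/funext => -[x y]; rewrite indicE in_setX /step_kernel /=.
by rewrite subrr normr0.
Qed.

(** The rectangles are stable under intersection, and the sets with an
    approximable indicator form a Dynkin class. *)
Lemma step_approximable_measurable (E : set (T * T)) :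
  measurable E -> step_approximable \1_E.
Proof.
move=> mE.
have E0 := @measurable_prod_measurableType _ _ T T.
apply: (dynkin_induction (P := fun E => step_approximable \1_E) E0);
  last (by rewrite -E0).
- move=> _ _ [A1 mA1 [A2 mA2 <-]] [B1 mB1 [B2 mB2 <-]].
  exists (A1 `&` B1); first exact: measurableI.
  exists (A2 `&` B2); first exact: measurableI.
  by rewrite setXI.
- by rewrite indicT; exact: step_approximable_cst.
- by move=> _ [A mA [B mB <-]]; exact: step_approximable_rectangle.
- move=> S mS hS.
  rewrite (_ : \1_(~` S) = fun z => 1 + (-1) * \1_S z :> R).
    by apply: step_approximable_lin => //; exact: step_approximable_cst.
  apply/funext => z; rewrite !indicE in_setC.
  by case: (z \in S); rewrite /= ?mulr1 ?mulr0 ?subrr ?addr0.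
- move=> F mF tF hF.
  have mU : measurable (\bigcup_k F k) by exact: bigcup_measurable.
  apply: step_approximable_limit; first exact: bounded_measurable_indic.
  move=> eps eps0.
  pose U n := \big[setU/set0]_(k < n.+1) F k.
  have UE : \bigcup_n U n = \bigcup_k F k by exact: bigcup_bigsetU_bigcup.
  have mUn n : measurable (U n) by apply: bigsetU_measurable.
  have [n Un] : exists n, fine (PP (\bigcup_k F k)) - fine (PP (U n)) <= eps.
    have h : (fun n => fine (PP (U n))) @ \oo --> fine (PP (\bigcup_k F k)).
      have PF : PP (\bigcup_k F k) \is a fin_num.
        by rewrite ge0_fin_numE // (le_lt_trans (probability_le1 _ mU)) ?ltry.
      apply: fine_cvg; rewrite fineK //.
      rewrite -UE; apply: nondecreasing_cvg_mu => //; first by rewrite UE.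
      by move=> m n mn; apply/subsetPset; exact: subset_bigsetU.
    move/cvgrPdist_le : h => /(_ _ eps0) [n _ h].
    by exists n; apply: le_trans (h n (leqnn n)); exact: ler_norm.
  exists \1_(U n).
    rewrite (_ : \1_(U n) = fun z => \sum_(k < n.+1) (\1_(F k) z : R)).
      exact: step_approximable_sum.
    apply/funext => z; rewrite /U; elim: n.+1 => [|m IH].
      by rewrite !big_ord0 indic0.
    rewrite !big_ord_recr /= -IH !indicE in_setU.
    have [Fm|//] := boolP (z \in F m); last by rewrite orbF addr0.
    case: (boolP (z \in _)) => [/set_mem|_]; last by rewrite add0r.
    rewrite -bigcup_mkord => -[k /= km Fk].
    have kmE : k = m by apply: tF => //; exists z; split=> //; exact: set_mem.
    by rewrite kmE ltnn in km.
  have sub z : \1_(U n) z <= \1_(\bigcup_k F k) z :> R.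
    rewrite !indicE ler_nat; case: (boolP (z \in U n)) => // /set_mem Uz.
    rewrite (_ : z \in _) // mem_set //.
    exact: (bigsetU_bigcup Uz).
  under eq_Rintegral do rewrite ger0_norm ?subr_ge0 //.
  rewrite RintegralB //; try by
    apply: bounded_measurable_integrable; exact: bounded_measurable_indic.
  by rewrite !Rintegral_indic.
Qed.

(** Rounding t down to a multiple of del, as a sum of threshold indicators. *)
Lemma staircase (t del : R) n : 0 <= t -> 0 <= del -> t <= n%:R * del ->
  let s := \sum_(k < n) del * (k.+1%:R * del <= t)%R%:R in s <= t <= s + del.
Proof.
move=> t0 d0 tn /=.
suff [h1 h2] : (n%:R * del <= t ->
    \sum_(k < n) del * (k.+1%:R * del <= t)%R%:R = n%:R * del)
  /\ (t <= n%:R * del -> \sum_(k < n) del * (k.+1%:R * del <= t)%R%:R <= t <=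
       \sum_(k < n) del * (k.+1%:R * del <= t)%R%:R + del) by exact: h2.
elim: n {tn} => [|n [IH1 IH2]].
  by rewrite big_ord0 mul0r add0r t0; split=> // h; rewrite (le_trans h).
have nS : n.+1%:R * del = n%:R * del + del by rewrite -natr1 mulrDl mul1r.
split=> [h|h]; rewrite big_ord_recr /=.
  by rewrite h IH1 ?mulr1 // (le_trans _ h) // nS lerDl.
case: (lerP (n.+1%:R * del) t) => h'.
  rewrite IH1 ?mulr1; last by rewrite (le_trans _ h') // nS lerDl.
  by rewrite -nS h' (le_trans h) // lerDl.
rewrite mulr0 addr0; case: (lerP t (n%:R * del)) => [/IH2 //|h2].
by rewrite IH1 ltW //= -nS.
Qed.

Lemma step_approximable_ge0 (K : T * T -> R) :
  bounded_measurable K -> (forall z, 0 <= K z) -> step_approximable K.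
Proof.
move=> bK K0; have [mK [M KM]] := bK.
apply: step_approximable_limit => // eps eps0.
pose n := (Num.truncn (M / eps)).+1.
have Mn z : K z <= n%:R * eps.
  rewrite -ler_pdivrMr //; apply: le_trans (ltW (truncnS_gt _)).
  by rewrite ler_pM2r ?invr_gt0 // (le_trans (ler_norm _)).
pose E (k : 'I_n) : set (T * T) := [set z | k.+1%:R * eps <= K z].
have mE k : measurable (E k).
  rewrite /E (_ : [set z | _] = K @^-1` `[k.+1%:R * eps, +oo[%classic).
    by rewrite -[_ @^-1` _]setTI; apply: mK => //; exact: measurable_itv.
  by apply/seteqP; split=> z /=; rewrite in_itv /= andbT.
have E1 z k : \1_(E k) z = (k.+1%:R * eps <= K z)%R%:R :> R.
  by rewrite indicE /E; congr (nat_of_bool _)%:R; apply/idP/idP => [/set_mem|/mem_set].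
pose g z := \sum_(k < n) (0 + eps * \1_(E k) z).
exists g.
  apply: step_approximable_sum => k; apply: step_approximable_lin.
    exact: step_approximable_cst.
  exact: step_approximable_measurable.
rewrite -[leRHS](Rintegral_const PP); apply: Rintegral_mono.
- apply: bounded_measurable_norm; apply: bounded_measurableB => //.
  apply: bounded_measurable_sum => k _; apply: bounded_measurableD.
    exact: bounded_measurable_cst.
  apply: bounded_measurableM; first exact: bounded_measurable_cst.
  exact: bounded_measurable_indic.
- exact: bounded_measurable_cst.
- move=> z.
  have := staircase (K0 z) (ltW eps0) (Mn z) => /=.
  rewrite (_ : \sum_(k < n) _ = g z); last first.
    by apply: eq_bigr => k _; rewrite E1 add0r.
  by move=> /andP[h1 h2]; rewrite ger0_norm ?subr_ge0 // lerBlDl.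
Qed.

End StepApproximation.

(** * Block averages and continuity of the density *)

Section ConditionalExpectation.
Context {R : realType} d (T : measurableType d) (P : probability T R).
Local Notation PP := (P \x P)%E.

Lemma Rintegral_swap (f : T * T -> R) : bounded_measurable f ->
  \int[PP]_z f (z.2, z.1) = \int[PP]_z f z.
Proof.
move=> bf.
have bs : bounded_measurable (fun z : T * T => f (z.2, z.1)).
  apply: (bounded_measurable_comp _ bf).
  by apply: measurable_fun_pair; [exact: measurable_snd|exact: measurable_fst].
rewrite Rintegral_fubini //; apply: EFin_inj.
rewrite (EFin_Rintegral (bounded_measurable_integrable PP bf)).
rewrite -integral21_prod_meas1; last exact: bounded_measurable_integrable.
rewrite EFin_Rintegral; last first.
  by apply: bounded_measurable_integrable; exact: (bounded_measurable_inner P P bs).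
apply: eq_integral => y _.
rewrite EFin_Rintegral //; apply: bounded_measurable_integrable.
exact: (bounded_measurable_section y bs).
Qed.

Variables (K : T * T -> R) (M : R).
Hypothesis K_dnn : bounded_dnn_kernel P K.
Hypothesis K_le : forall z, K z <= M.

Lemma dnn_bounded_measurable : bounded_measurable K.
Proof. by split; [exact: dnn_measurable K_dnn|exact: dnn_bounded K_dnn]. Qed.

Variables (J : finType) (psi : T -> J).
Hypothesis mpsi : fibers_measurable psi.
Local Notation p := (law P psi).
Local Notation ind := (fiber_ind psi).

Let bK := dnn_bounded_measurable.

Definition block_mass (i j : J) : R := \int[PP]_z (ind i z.1 * ind j z.2 * K z).

(** With the convention 1/0 = 0, blocks of measure zero get the average 0. *)
Definition block_average (i j : J) : R := block_mass i j * (p i)^-1 * (p j)^-1.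

Let b_ind2 i j : bounded_measurable (fun z : T * T => ind i z.1 * ind j z.2 : R).
Proof.
apply: bounded_measurableM.
  exact: (bounded_measurable_comp measurable_fst
    (bounded_measurable_fiber_ind mpsi i)).
exact: (bounded_measurable_comp measurable_snd
  (bounded_measurable_fiber_ind mpsi j)).
Qed.

Let ind2_ge0 i j (z : T * T) : 0 <= ind i z.1 * ind j z.2 :> R.
Proof. by rewrite mulr_ge0 // ler0n. Qed.

Lemma block_mass_ge0 i j : 0 <= block_mass i j.
Proof.
by apply: Rintegral_ge0 => z _; rewrite mulr_ge0 // (dnn_ge0 K_dnn).
Qed.

Lemma Rintegral_block i j : \int[PP]_z (ind i z.1 * ind j z.2) = p i * p j.
Proof. by apply: Rintegral_prod2; exact: bounded_measurable_fiber_ind. Qed.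

Lemma block_mass_le i j : block_mass i j <= M * (p i * p j).
Proof.
rewrite -Rintegral_block -Rintegral_scale //; apply: Rintegral_mono.
- exact: bounded_measurableM.
- by apply: bounded_measurableM => //; exact: bounded_measurable_cst.
- by move=> z; rewrite mulrC ler_wpM2r.
Qed.

Lemma block_massE i j : block_mass i j = block_average i j * (p i * p j).
Proof.
rewrite /block_average; have := block_mass_le i j.
have [->|pi0] := eqVneq (p i) 0.
  rewrite !(mul0r, mulr0) => h; apply/eqP.
  by rewrite eq_le h block_mass_ge0.
have [->|pj0] := eqVneq (p j) 0.
  rewrite !(mul0r, mulr0) => h; apply/eqP.
  by rewrite eq_le h block_mass_ge0.
by move=> _; field; rewrite pi0 pj0.
Qed.

Lemma block_average_ge0 i j : 0 <= block_average i j.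
Proof. by rewrite !mulr_ge0 ?invr_ge0 ?law_ge0 ?block_mass_ge0. Qed.

Lemma block_average_le i j : 0 <= M -> block_average i j <= M.
Proof.
move=> M0; have [pi0|pi0] := eqVneq (p i) 0.
  by rewrite /block_average pi0 invr0 mulr0 mul0r.
have [pj0|pj0] := eqVneq (p j) 0.
  by rewrite /block_average pj0 invr0 mulr0.
have pij : 0 < p i * p j by rewrite mulr_gt0 // lt_def law_ge0 ?pi0 ?pj0.
by rewrite -(ler_pM2r pij) -block_massE block_mass_le.
Qed.

Lemma Rintegral_blocks (h : J -> J -> R) :
  \int[PP]_z (h (psi z.1) (psi z.2) * K z) = \sum_i \sum_j h i j * block_mass i j.
Proof.
rewrite (Rintegral_fibers (fibers_measurable_pair mpsi)
  (fun ij => h ij.1 ij.2) (bounded_measurable_integrable PP bK)) pair_bigA.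
apply: eq_bigr => -[i j] _ /=.
by congr (_ * _); apply: eq_Rintegral => z _; rewrite fiber_ind_pair.
Qed.

(** The form of the block averages at f is that of K at the step function with
    value f i / p i on block i. *)
Lemma block_average_dnn : fin_dnn block_average.
Proof.
split; first exact: block_average_ge0.
  move=> i j; rewrite /block_average mulrAC; congr (_ * _ * _).
  rewrite /block_mass -[RHS]Rintegral_swap /=; last exact: bounded_measurableM.
  apply: eq_Rintegral => -[x y] _ /=.
  by rewrite (dnn_symmetric K_dnn) [ind i x * _]mulrC.
move=> f; pose g x : R := f (psi x) * (p (psi x))^-1.
have [mg [B gB]] : bounded_measurable g.
  exact: (bounded_measurable_finite mpsi (fun i => f i * (p i)^-1)).
have := dnn_psd K_dnn mg (ex_intro _ B gB).
pose h i j : R := (f i * (p i)^-1) * (f j * (p j)^-1).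
rewrite (_ : \int[PP]_z _ = \int[PP]_z (h (psi z.1) (psi z.2) * K z)).
  rewrite Rintegral_blocks => /le_trans; apply; rewrite le_eqVlt; apply/orP; left.
  apply/eqP; apply: eq_bigr => i _; apply: eq_bigr => j _.
  by rewrite /h /block_average; ring.
by apply: eq_Rintegral => z _; rewrite /h /g; ring.
Qed.

Lemma block_average_norm1 : bilin block_average p p = kernel_norm1 P K.
Proof.
transitivity (\int[PP]_z (1 * K z)); last first.
  by apply: eq_Rintegral => z _; rewrite mul1r.
rewrite (Rintegral_blocks (fun _ _ => 1)).
apply: eq_bigr => i _; apply: eq_bigr => j _.
by rewrite mul1r block_massE; ring.
Qed.

(** Averaging over the blocks is an L1 contraction that fixes step kernels. *)
Lemma block_average_dist (a : J -> J -> R) :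
  \int[PP]_z `|K z - step_kernel psi block_average z| <=
  2 * \int[PP]_z `|K z - step_kernel psi a z|.
Proof.
have ba := bounded_measurable_step mpsi a.
have bb := bounded_measurable_step mpsi block_average.
apply: le_trans (Rintegral_dist_triangle PP bK ba bb) _.
rewrite mulr_natl mulr2n lerD2l.
have bd : bounded_measurable (fun z => `|K z - step_kernel psi a z|).
  by apply: bounded_measurable_norm; exact: bounded_measurableB.
have -> : \int[PP]_z `|step_kernel psi a z - step_kernel psi block_average z| =
    \sum_i \sum_j `|a i j - block_average i j| * (p i * p j).
  rewrite pair_bigA; apply: etrans (Rintegral_finite PP
    (fibers_measurable_pair mpsi)
    (fun ij => `|a ij.1 ij.2 - block_average ij.1 ij.2|)) _.
  apply: eq_bigr => -[i j] _ /=; congr (_ * _).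
  rewrite -Rintegral_block; apply: eq_Rintegral => z _.
  by rewrite fiber_ind_pair.
have -> : \int[PP]_z `|K z - step_kernel psi a z| =
    \sum_i \sum_j \int[PP]_z (ind i z.1 * ind j z.2 * `|K z - step_kernel psi a z|).
  have := Rintegral_fibers (fibers_measurable_pair mpsi) (fun=> 1)
    (bounded_measurable_integrable PP bd).
  under eq_Rintegral do rewrite mul1r.
  move=> ->; rewrite pair_bigA; apply: eq_bigr => -[i j] _ /=.
  rewrite mul1r; apply: eq_Rintegral => z _.
  by rewrite fiber_ind_pair.
apply: ler_sum => i _; apply: ler_sum => j _.
have pij : 0 <= p i * p j by rewrite mulr_ge0 ?law_ge0.
rewrite -[X in _ * X](ger0_norm pij) -normrM mulrBl -block_massE.
rewrite -Rintegral_block -Rintegral_scale // /block_mass -RintegralB //;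
  try by apply: bounded_measurable_integrable; apply: bounded_measurableM => //;
    exact: bounded_measurable_cst.
have bij : bounded_measurable
    (fun z : T * T => ind i z.1 * ind j z.2 * (K z - step_kernel psi a z)).
  by apply: bounded_measurableM => //; exact: bounded_measurableB.
have -> : \int[PP]_z (a i j * (ind i z.1 * ind j z.2) - ind i z.1 * ind j z.2 * K z)
    = - \int[PP]_z (ind i z.1 * ind j z.2 * (K z - step_kernel psi a z)).
  rewrite -mulN1r -Rintegral_scale //; apply: eq_Rintegral => z _.
  rewrite /step_kernel /fiber_ind.
  by case: eqP => [->|_]; case: eqP => [->|_]; rewrite ?mulr0 ?mul0r; ring.
rewrite normrN; apply: le_trans (le_normr_Rintegral _ _) _ => //.
  exact: bounded_measurable_integrable.
rewrite le_eqVlt; apply/orP; left; apply/eqP; apply: eq_Rintegral => z _.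
by rewrite normrM ger0_norm.
Qed.

End ConditionalExpectation.

Lemma exists_step_approximation (R : realType) d (T : measurableType d)
    (P : probability T R) (K : T * T -> R) (eps : R) :
  bounded_dnn_kernel P K -> 0 < eps ->
  exists (J : finType) (psi : T -> J), fibers_measurable psi /\
    \int[(P \x P)%E]_z `|K z - step_kernel psi (block_average P K psi) z| <= eps.
Proof.
move=> K_dnn eps0; have [B KB] := dnn_bounded K_dnn.
have bK := dnn_bounded_measurable K_dnn.
have [_ h] := step_approximable_ge0 P bK (dnn_ge0 K_dnn).
have [J [psi [a [mpsi ha]]]] := h (eps / 2) (divr_gt0 eps0 (ltr0Sn _ 1)).
exists J, psi; split=> //.
have KB' z : K z <= B by rewrite (le_trans (ler_norm _)).
apply: le_trans (block_average_dist K_dnn KB' mpsi a) _.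
by rewrite mulrC -ler_pdivlMr.
Qed.

Section DensityContinuity.
Context {R : realType} d (T : measurableType d) (P : probability T R).

(** The factors of a product are replaced one at a time. *)
Lemma dist_prod_le (I : Type) (s : seq I) (M : R) (a b : I -> R) : 1 <= M ->
  (forall i, `|a i| <= M) -> (forall i, `|b i| <= M) ->
  `|\prod_(i <- s) a i - \prod_(i <- s) b i| <=
  M ^+ size s * \sum_(i <- s) `|a i - b i|.
Proof.
move=> M1 aM bM; have M0 : 0 <= M := le_trans ler01 M1.
elim: s => [|i s IH]; first by rewrite !big_nil subrr normr0 mulr0.
rewrite !big_cons /= exprS.
set A := \prod_(j <- s) a j; set B := \prod_(j <- s) b j; set S := \sum_(j <- s) _.
have BM : `|B| <= M ^+ size s.
  rewrite /B normr_prod; elim: s {IH A B S} => [|j s IH]; first by rewrite big_nil.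
  by rewrite big_cons exprS ler_pM // prodr_ge0.
have -> : a i * A - b i * B = a i * (A - B) + (a i - b i) * B by ring.
apply: le_trans (ler_normD _ _) _; rewrite !normrM mulrDr addrC lerD //.
  rewrite mulrC -mulrA; apply: le_trans (_ : M ^+ size s * `|a i - b i| <= _).
    by apply: ler_wpM2r.
  rewrite mulrCA; apply: ler_wpM2l; first exact: exprn_ge0.
  by rewrite ler_peMl.
by rewrite -mulrA; apply: ler_pM.
Qed.

Lemma bounded_measurable_edge (F : simple_graph) (H : T * T -> R) (q : F * F) :
  bounded_measurable H -> bounded_measurable (fun x : #|F|.-tuple T =>
    H (tnth x (enum_rank q.1), tnth x (enum_rank q.2))).
Proof.
move=> bH; apply: (bounded_measurable_comp _ bH).
by apply: measurable_fun_pair; exact: measurable_tnth.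
Qed.

(** Telescope the product over the edges; the two endpoints of an edge are
    independent, so each edge costs the L1 distance of the kernels. *)
Lemma dist_hom_density_le (F : simple_graph) (H K : T * T -> R) (M : R) :
  1 <= M -> measurable_fun setT H -> measurable_fun setT K ->
  (forall z, `|H z| <= M) -> (forall z, `|K z| <= M) ->
  hom_density P F H - hom_density P F K <=
  M ^+ edge_count F * (edge_count F)%:R * \int[(P \x P)%E]_z `|H z - K z|.
Proof.
move=> M1 mH mK HM KM.
have bH : bounded_measurable H by split=> //; exists M.
have bK : bounded_measurable K by split=> //; exists M.
have bD : bounded_measurable (fun z => `|H z - K z|).
  by apply: bounded_measurable_norm; exact: bounded_measurableB.
have bp (L : T * T -> R) : bounded_measurable L ->
    bounded_measurable (fun x : #|F|.-tuple T =>
      \prod_(q in edges F) L (tnth x (enum_rank q.1), tnth x (enum_rank q.2))).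
  by move=> bL; apply: bounded_measurable_prod => q _; exact: bounded_measurable_edge.
rewrite /hom_density -RintegralB //; try by
  apply: bounded_measurable_integrable; exact: bp.
pose S (x : #|F|.-tuple T) :=
  \sum_(q in edges F) `|H (tnth x (enum_rank q.1), tnth x (enum_rank q.2)) -
                        K (tnth x (enum_rank q.1), tnth x (enum_rank q.2))|.
have bS : bounded_measurable S.
  by apply: bounded_measurable_sum => q _; apply: (bounded_measurable_edge _ bD).
apply: (@le_trans _ _ (\int[power_probability P #|F|]_x (M ^+ edge_count F * S x))).
  apply: Rintegral_mono.
  - by apply: bounded_measurableB; exact: bp.
  - by apply: bounded_measurableM => //; exact: bounded_measurable_cst.
  - move=> x; apply: le_trans (ler_norm _) _.
    rewrite /S -!big_enum /edge_count cardE.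
    exact: dist_prod_le.
rewrite Rintegral_scale // -mulrA; apply: ler_wpM2l.
  by rewrite exprn_ge0 // (le_trans ler01).
rewrite /S Rintegral_sum; last first.
  move=> q; apply: bounded_measurable_integrable.
  exact: (bounded_measurable_edge _ bD).
rewrite /edge_count -sumr_const mulr_suml; apply: ler_sum => q.
rewrite inE => /andP[_ q12]; rewrite mul1r.
by rewrite (Rintegral_power_tnth2 P q12 bD).
Qed.

End DensityContinuity.

(** * Integral operators on L2 *)

(** Positivity of the form at G - r g, where G is the image of g, bounds the norm
    of the operator by its Rayleigh quotients: the cross terms are both the
    squared norm of G. *)
Lemma psd_operator_le (R : realFieldType) (J : finType) (p g : J -> R)
    (a : J -> J -> R) (r : R) : psd a -> (forall i j, a i j = a j i) ->
  (forall u : J -> R, bilin a (fun i => p i * u i) (fun i => p i * u i) <=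
    r * \sum_i p i * u i ^+ 2) ->
  0 < r -> \sum_j p j * g j ^+ 2 <= 1 ->
  \sum_i (\sum_j a i j * (p j * g j)) ^+ 2 * p i <= r ^+ 2.
Proof.
move=> pa sa hr r0 g1.
pose G i := \sum_j a i j * (p j * g j).
pose pG i := p i * G i; pose pg i := p i * g i.
set X := \sum_i _.
have XE : X = \sum_i p i * G i ^+ 2 by apply: eq_bigr => i _; rewrite mulrC.
have GG : bilin a pG pG <= r * X by rewrite XE; exact: hr.
have gg : bilin a pg pg <= r.
  by apply: le_trans (hr g) _; rewrite -[leRHS]mulr1 ler_wpM2l // ltW.
have Gg : bilin a pG pg = X.
  rewrite XE; apply: eq_bigr => i _; rewrite expr2 mulrA [X in _ = _ * X]/G mulr_sumr.
  by apply: eq_bigr => j _; rewrite /pG /pg; ring.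
have gG : bilin a pg pG = X.
  rewrite -Gg /bilin exchange_big; apply: eq_bigr => i _; apply: eq_bigr => j _ /=.
  by rewrite sa; ring.
have := pa (fun i => pG i + (- r) * pg i).
rewrite bilin_combination Gg gG sqrrN => h.
have {}h : 0 <= r * (r ^+ 2 - X).
  apply: le_trans h _; apply: le_trans (lerD (lerD GG (lexx _))
    (ler_wpM2l (sqr_ge0 r) gg)) _.
  by rewrite le_eqVlt; apply/orP; left; apply/eqP; ring.
by rewrite -subr_ge0 -(pmulr_rge0 _ r0).
Qed.

Section OperatorNorm.
Context {R : realType} d (T : measurableType d) (P : probability T R).
Local Notation PP := (P \x P)%E.

Lemma Lfun2_integrable (f : T -> R) : f \in Lfun P 2%:E ->
  P.-integrable setT (EFin \o f).
Proof.
move=> f2; apply/Lfun1_integrable; apply: Lfun_subset12 => //.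
by rewrite [X in X \is a _](probability_setT P).
Qed.

Lemma Lnorm2E (f : T -> R) : P.-integrable setT (EFin \o (fun x => f x ^+ 2)) ->
  'N[P]_2%:E[EFin \o f]%E = (Num.sqrt (\int[P]_x f x ^+ 2))%:E.
Proof.
move=> fi; rewrite unlock.
rewrite (eq_integral (fun x => (f x ^+ 2)%:E)); last first.
  by move=> x _ /=; rewrite powR_mulrn // real_normK ?num_real.
rewrite -(EFin_Rintegral fi) poweR12_sqrt //.
by rewrite lee_fin; apply: Rintegral_ge0 => x _; exact: sqr_ge0.
Qed.

Lemma bounded_measurable_integrable_sqr (g : T -> R) : bounded_measurable g ->
  P.-integrable setT (EFin \o (fun x => g x ^+ 2)).
Proof.
move=> bg; apply: bounded_measurable_integrable.
have -> : (fun x => g x ^+ 2) = (fun x => g x * g x) by apply/funext => x.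
exact: bounded_measurableM.
Qed.

Definition unit_ball2 (f : T -> R) : Prop :=
  f \in Lfun P 2%:E /\ \int[P]_x f x ^+ 2 <= 1.

Lemma unit_ball2P (f : T -> R) : f \in Lfun P 2%:E ->
  ('N[P]_2%:E[EFin \o f] <= 1)%E -> unit_ball2 f.
Proof.
move=> f2; rewrite (Lnorm2E (Lfun2_integrable_sqr f2)) lee_fin => h; split=> //.
by rewrite -[leRHS]sqrtr1 ler_sqrt // in h.
Qed.

(** Expand the integral of (h - s f)^2, where s is the integral of h f. *)
Lemma Rintegral_mul_unit_sqr (h f : T -> R) : bounded_measurable h ->
  unit_ball2 f -> (\int[P]_x (h x * f x)) ^+ 2 <= \int[P]_x (h x ^+ 2).
Proof.
move=> bh [f2 f1]; set s := \int[P]_x _.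
have ih2 := bounded_measurable_integrable_sqr bh.
have if2 := Lfun2_integrable_sqr f2.
have ihf := integrable_mul_bounded bh (Lfun2_integrable f2).
have i1 : P.-integrable setT (EFin \o (fun x => (- (2 * s)) * (h x * f x))).
  by apply: integrable_mul_bounded => //; exact: bounded_measurable_cst.
have i2 : P.-integrable setT (EFin \o (fun x => s ^+ 2 * f x ^+ 2)).
  by apply: integrable_mul_bounded => //; exact: bounded_measurable_cst.
have i3 : P.-integrable setT
    (EFin \o (fun x => h x ^+ 2 + (- (2 * s)) * (h x * f x))).
  exact: (integrableD measurableT ih2 i1).
have : 0 <= \int[P]_x (h x ^+ 2 + (- (2 * s)) * (h x * f x) + s ^+ 2 * f x ^+ 2).
  apply: Rintegral_ge0 => x _.
  rewrite (_ : _ + _ = (h x - s * f x) ^+ 2) ?sqr_ge0 //; ring.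
rewrite RintegralD // RintegralD // !RintegralZl // -/s => h0.
rewrite -subr_ge0; apply: le_trans h0 _.
have : s ^+ 2 * \int[P]_x f x ^+ 2 <= s ^+ 2.
  by rewrite -[leRHS]mulr1 ler_wpM2l // sqr_ge0.
by lra.
Qed.

(** Fubini: the inner integral of |f| does not depend on the outer variable. *)
Lemma integrable_snd (f : T -> R) : P.-integrable setT (EFin \o f) ->
  PP.-integrable setT (EFin \o (fun z : T * T => f z.2)).
Proof.
move=> fi; have /integrableP[mf flty] := fi.
apply/(integrable12ltyP P P).
  by apply: (measurableT_comp mf); exact: measurable_snd.
rewrite /= integral_cst // [X in (_ * X)%E](probability_setT P) mule1.
exact: flty.
Qed.

Section Operator.
Variables (H : T * T -> R) (f : T -> R).
Hypotheses (bH : bounded_measurable H) (f_unit : unit_ball2 f).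

Lemma kernel_op_sqr_le x :
  kernel_op P H f x ^+ 2 <= \int[P]_y (H (x, y) ^+ 2).
Proof.
by apply: Rintegral_mul_unit_sqr => //; exact: bounded_measurable_section.
Qed.

Lemma kernel_op_bound (M : R) x : 0 <= M -> (forall z, `|H z| <= M) ->
  `|kernel_op P H f x| <= M.
Proof.
move=> M0 HM; rewrite -(ler_pXn2r (ltn0Sn 1)) ?nnegrE //.
rewrite real_normK ?num_real //; apply: le_trans (kernel_op_sqr_le x) _.
rewrite -[leRHS](Rintegral_const P); apply: Rintegral_mono.
- apply: (bounded_measurable_section x (f := fun z => H z ^+ 2)).
  have -> : (fun z => H z ^+ 2) = (fun z => H z * H z) by apply/funext => z.
  exact: bounded_measurableM.
- exact: bounded_measurable_cst.
- by move=> y; rewrite -[H (x, y) ^+ 2]real_normK ?num_real // lerXn2r ?nnegrE.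
Qed.

Lemma bounded_measurable_kernel_op : bounded_measurable (kernel_op P H f).
Proof.
split; last first.
  have [_ [M HM]] := bH; exists `|M| => x; apply: kernel_op_bound => // z.
  by rewrite (le_trans (HM z)) // ler_norm.
have fi := Lfun2_integrable f_unit.1.
apply/measurable_EFinP.
have -> : EFin \o kernel_op P H f =
    fubini_F P (EFin \o (fun z : T * T => H z * f z.2)).
  apply/funext => x /=; rewrite EFin_Rintegral //.
  by apply: integrable_mul_bounded => //; exact: bounded_measurable_section.
apply: (@measurable_fubini_F _ _ _ _ _ P).
by apply: integrable_mul_bounded => //; exact: integrable_snd.
Qed.

(** Cauchy-Schwarz in the second variable. *)
Lemma kernel_op_hilbert_schmidt :
  \int[P]_x (kernel_op P H f x ^+ 2) <= \int[PP]_z (H z ^+ 2).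
Proof.
have bH2 : bounded_measurable (fun z => H z ^+ 2).
  have -> : (fun z => H z ^+ 2) = (fun z => H z * H z) by apply/funext => z.
  exact: bounded_measurableM.
rewrite Rintegral_fubini //; apply: le_Rintegral => //.
- exact: (bounded_measurable_integrable_sqr bounded_measurable_kernel_op).
- by apply: bounded_measurable_integrable; exact: (bounded_measurable_inner P P bH2).
- by move=> x _; exact: kernel_op_sqr_le.
Qed.

End Operator.

Lemma kernel_opD (H K : T * T -> R) (f : T -> R) x : bounded_measurable H ->
  bounded_measurable K -> unit_ball2 f ->
  kernel_op P K f x = kernel_op P H f x + kernel_op P (fun z => K z - H z) f x.
Proof.
move=> bH bK [f2 _]; have fi := Lfun2_integrable f2.
rewrite /kernel_op -RintegralD //; last 2 first.
- by apply: integrable_mul_bounded => //; exact: bounded_measurable_section.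
- apply: integrable_mul_bounded => //.
  by apply: (bounded_measurable_section x (f := fun z => K z - H z));
    exact: bounded_measurableB.
by apply: eq_Rintegral => y _; ring.
Qed.

Section StepOperator.
Variables (J : finType) (psi : T -> J) (mpsi : fibers_measurable psi).
Local Notation p := (law P psi).

(** Only the averages of f over the blocks matter, and averaging is an L2
    contraction. *)
Lemma step_op_le (a : J -> J -> R) (f : T -> R) (r : R) : fin_dnn a ->
  (forall i j, p j = 0 -> a i j = 0) ->
  (forall u : J -> R, bilin a (fun i => p i * u i) (fun i => p i * u i) <=
    r * \sum_i p i * u i ^+ 2) ->
  0 < r -> unit_ball2 f ->
  \int[P]_x (kernel_op P (step_kernel psi a) f x ^+ 2) <= r ^+ 2.
Proof.
move=> [a0 sa pa] ap hr r0 f_unit; have [f2 f1] := f_unit.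
have fi := Lfun2_integrable f2.
pose F j := \int[P]_x (fiber_ind psi j x * f x).
pose g j := F j / p j.
have opE x : kernel_op P (step_kernel psi a) f x =
    (fun i => \sum_j a i j * (p j * g j)) (psi x).
  rewrite /kernel_op /step_kernel /= (Rintegral_fibers mpsi (a (psi x)) fi).
  apply: eq_bigr => j _; rewrite -/(F j) /g.
  have [pj0|pj0] := eqVneq (p j) 0; first by rewrite ap // !mul0r.
  by congr (_ * _); rewrite mulrC divfK.
under eq_Rintegral do rewrite opE.
rewrite (Rintegral_finite P mpsi (fun i => (\sum_j a i j * (p j * g j)) ^+ 2)).
apply: psd_operator_le => //.
have bg : bounded_measurable (fun x => g (psi x)) by exact: bounded_measurable_finite.
have if2 := Lfun2_integrable_sqr f2.
have ig2 := bounded_measurable_integrable_sqr bg.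
have bg2 : bounded_measurable (fun x => - (2 * g (psi x))).
  exact: (bounded_measurable_finite mpsi (fun i => - (2 * g i))).
have igf := integrable_mul_bounded bg2 fi.
have i3 : P.-integrable setT
    (EFin \o (fun x => f x ^+ 2 + (- (2 * g (psi x))) * f x)).
  exact: (integrableD measurableT if2 igf).
have : 0 <= \int[P]_x (f x ^+ 2 + (- (2 * g (psi x))) * f x + g (psi x) ^+ 2).
  apply: Rintegral_ge0 => x _.
  rewrite (_ : _ + _ = (f x - g (psi x)) ^+ 2) ?sqr_ge0 //; ring.
rewrite RintegralD // RintegralD //.
rewrite (Rintegral_fibers mpsi (fun i => - (2 * g i)) fi).
rewrite (Rintegral_finite P mpsi (fun i => g i ^+ 2)).
rewrite (_ : \sum_j - (2 * g j) * _ = - (2 * \sum_j p j * g j ^+ 2)); last first.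
  rewrite mulr_sumr -sumrN; apply: eq_bigr => j _; rewrite -/(F j) /g.
  have [pj0|pj0] := eqVneq (p j) 0; last by field.
  by rewrite pj0 invr0 !(mulr0, mul0r, oppr0).
rewrite (_ : \sum_j g j ^+ 2 * p j = \sum_j p j * g j ^+ 2); last first.
  by apply: eq_bigr => j _; rewrite mulrC.
lra.
Qed.

End StepOperator.
End OperatorNorm.

(** * Comparison with the operator norm *)

Section OperatorNormBounds.
Context {R : realType} d (T : measurableType d) (P : probability T R).
Local Notation PP := (P \x P)%E.
Variable K : T * T -> R.
Hypothesis K_dnn : bounded_dnn_kernel P K.

Let bK : bounded_measurable K := dnn_bounded_measurable K_dnn.

Lemma kernel_norm1_ge0 : 0 <= kernel_norm1 P K.
Proof. by apply: Rintegral_ge0 => z _; exact: (dnn_ge0 K_dnn). Qed.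

Lemma hom_density_ge0 (F : simple_graph) : 0 <= hom_density P F K.
Proof.
by apply: Rintegral_ge0 => x _; apply: prodr_ge0 => q _; exact: (dnn_ge0 K_dnn).
Qed.

Lemma kernel_norm1_eq0P : kernel_norm1 P K = 0 <-> {ae PP, forall z, K z = 0}.
Proof.
have mK : measurable_fun setT (EFin \o K) by apply/measurable_EFinP; case: bK.
have KE : (\int[PP]_z `|(K z)%:E|)%E = (kernel_norm1 P K)%:E.
  rewrite /kernel_norm1 (EFin_Rintegral (bounded_measurable_integrable PP bK)).
  by apply: eq_integral => z _; rewrite gee0_abs // lee_fin (dnn_ge0 K_dnn).
have := ae_eq_integral_abs PP measurableT mK; rewrite KE => h.
split=> [K0|K0].
  move: h.1; rewrite K0 => /(_ erefl); apply: filterS => z /= /(_ I).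
  by case.
apply: EFin_inj; apply: h.2; move: K0; apply: filterS => z /= -> //.
Qed.

Lemma fine_Lnorm2_kernel_op (f : T -> R) : unit_ball2 P f ->
  fine 'N[P]_2%:E[EFin \o kernel_op P K f]%E =
  Num.sqrt (\int[P]_x (kernel_op P K f x ^+ 2)).
Proof.
move=> f1; rewrite Lnorm2E //.
apply: bounded_measurable_integrable_sqr.
exact: bounded_measurable_kernel_op.
Qed.

Lemma unit_ball2_cst1 : unit_ball2 P (cst 1).
Proof.
split; first exact: Lfun_cst.
by under eq_Rintegral do rewrite /= expr1n; rewrite Rintegral_const.
Qed.

Let norms := [set fine 'N[P]_2%:E[EFin \o kernel_op P K f]%E | f in
  [set f : T -> R | f \in Lfun P 2%:E /\ ('N[P]_2%:E[EFin \o f] <= 1)%E]].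

Let norms1 : norms (fine 'N[P]_2%:E[EFin \o kernel_op P K (cst 1%R)]%E).
Proof.
exists (cst 1) => //; split; first exact: Lfun_cst.
by rewrite Lnorm_cst1 [X in (X `^ _)%E](probability_setT P) poweR1r.
Qed.

Lemma kernel_opnorm_le (r : R) : 0 <= r ->
  (forall f, unit_ball2 P f -> \int[P]_x (kernel_op P K f x ^+ 2) <= r ^+ 2) ->
  kernel_opnorm P K <= r.
Proof.
move=> r0 h; apply: ge_sup; first by eexists; exact: norms1.
move=> _ [f [f2 fN] <-]; have f1 := unit_ball2P f2 fN.
by rewrite fine_Lnorm2_kernel_op // -[leRHS]ger0_norm // -sqrtr_sqr ler_wsqrtr // h.
Qed.

Lemma has_ubound_norms : has_ubound norms.
Proof.
have [_ [M KM]] := bK.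
exists `|M| => _ [f [f2 fN] <-]; have f1 := unit_ball2P f2 fN.
rewrite fine_Lnorm2_kernel_op // -sqrtr_sqr ler_wsqrtr //.
rewrite -(Rintegral_const P (M ^+ 2)); apply: le_Rintegral => //.
- apply: bounded_measurable_integrable_sqr; exact: bounded_measurable_kernel_op.
- by apply: bounded_measurable_integrable; exact: bounded_measurable_cst.
- move=> x _; rewrite -[leLHS]real_normK ?num_real // -[leRHS]real_normK ?num_real //.
  rewrite lerXn2r ?nnegrE //; apply: kernel_op_bound => // z.
  by rewrite (le_trans (KM z)) // ler_norm.
Qed.

(** The constant function 1 lies in the unit ball, and its image has integral
    equal to the norm of K. *)
Lemma kernel_norm1_le_opnorm : kernel_norm1 P K <= kernel_opnorm P K.
Proof.
have c1 := unit_ball2_cst1.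
have bT := bounded_measurable_kernel_op bK c1.
apply: le_trans (ub_le_sup has_ubound_norms norms1).
rewrite fine_Lnorm2_kernel_op //.
rewrite -(ger0_norm kernel_norm1_ge0) -sqrtr_sqr ler_wsqrtr //.
apply: le_trans (Rintegral_mul_unit_sqr bT c1); rewrite le_eqVlt; apply/orP; left.
apply/eqP; congr (_ ^+ 2); rewrite /kernel_norm1 Rintegral_fubini //.
apply: eq_Rintegral => x _; rewrite /= mulr1.
by apply: eq_Rintegral => y _; rewrite /= mulr1.
Qed.

(** The operator of K is that of a block average of K, to which the finite
    inequality applies, plus a perturbation of small Hilbert-Schmidt norm. *)
Lemma Rintegral_kernel_op_sqr_le (F : simple_graph) (f : T -> R) (r : R) :
  fin_sidorenko R F -> (0 < edge_count F)%N ->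
  (vertex_count F <= edge_count F)%N -> 0 < r ->
  hom_density P F K * kernel_norm1 P K ^+ (edge_count F - vertex_count F) <
    r ^+ ((edge_count F).*2 - vertex_count F) ->
  unit_ball2 P f -> \int[P]_x (kernel_op P K f x ^+ 2) <= r ^+ 2.
Proof.
move=> Fgood e_gt0 le_ve r0; set B := _ * _; set rD := r ^+ _ => BrD f1.
have [mK [M0 KM0]] := bK.
pose M := Num.max 1 M0.
have M1 : 1 <= M by rewrite le_max lexx.
have M_ge0 : 0 <= M := le_trans ler01 M1.
have M_gt0 : 0 < M := lt_le_trans ltr01 M1.
have KM z : `|K z| <= M by rewrite (le_trans (KM0 z)) // le_max lexx orbT.
have KM' z : K z <= M := le_trans (ler_norm _) (KM z).
set S := kernel_norm1 P K ^+ (edge_count F - vertex_count F) in B BrD *.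
have S0 : 0 <= S by rewrite exprn_ge0 // kernel_norm1_ge0.
pose C := M ^+ edge_count F * (edge_count F)%:R.
have C0 : 0 <= C by rewrite mulr_ge0 // exprn_ge0.
apply/ler_addgt0Pr => e' e'0.
pose eta := e' / (r ^+ 2 + 1).
have r21 : 0 < r ^+ 2 + 1 by rewrite ltr_wpDl ?sqr_ge0.
have eta0 : 0 < eta by rewrite divr_gt0.
have eta1 : 0 < 1 + eta^-1 by rewrite ltr_wpDr ?invr_ge0 // ltW.
have CS1 : 0 < C * S + 1 by rewrite ltr_wpDl // mulr_ge0.
(* the first bound keeps the finite inequality at level r, the second absorbs
   the perturbation; eta balances the two terms in
   (h + g)^2 <= (1 + eta) h^2 + (1 + 1 / eta) g^2 *)
pose eps := Num.min ((rD - B) / (C * S + 1)) (eta / ((1 + eta^-1) * M)).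
have eps0 : 0 < eps.
  rewrite lt_min; apply/andP; split; first by rewrite divr_gt0 // subr_gt0.
  by rewrite divr_gt0 // mulr_gt0.
have eps1 : eps * (C * S + 1) <= rD - B.
  by rewrite -ler_pdivlMr // ge_min lexx.
have eps2 : eps * ((1 + eta^-1) * M) <= eta.
  by rewrite -ler_pdivlMr ?mulr_gt0 // ge_min lexx orbT.
have [J [psi [mpsi dist]]] := exists_step_approximation K_dnn eps0.
pose a := block_average P K psi.
have a_dnn : fin_dnn a by exact: (block_average_dnn K_dnn mpsi).
have [a0 _ _] := a_dnn.
pose H := step_kernel psi a.
have bH : bounded_measurable H by exact: bounded_measurable_step.
have HM z : `|H z| <= M.
  by rewrite ger0_norm ?a0 //; apply: (block_average_le K_dnn KM' mpsi).
have p_prob := law_prob P mpsi.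
pose D z := K z - H z.
have bD : bounded_measurable D by exact: bounded_measurableB.
have rayleigh (u : J -> R) :
    bilin a (fun i => law P psi i * u i) (fun i => law P psi i * u i) <=
    r * \sum_i law P psi i * u i ^+ 2.
  apply: (fin_rayleigh_le _ Fgood) => //; first exact: ltW.
  rewrite (block_average_norm1 K_dnn KM' mpsi) -/S -hom_density_step // -/H.
  apply: (@le_trans _ _ ((hom_density P F K + C * eps) * S)).
    apply: ler_wpM2r => //; rewrite -lerBlDl.
    apply: le_trans (dist_hom_density_le P F M1 bH.1 mK HM KM) _.
    apply: ler_wpM2l => //; apply: le_trans dist.
    by rewrite le_eqVlt; apply/orP; left; apply/eqP;
      apply: eq_Rintegral => z _; rewrite distrC.
  rewrite mulrDl -/B -lerBrDl; apply: le_trans eps1.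
  by rewrite mulrDr mulr1 mulrAC mulrC lerDl ltW.
have opH : \int[P]_x (kernel_op P H f x ^+ 2) <= r ^+ 2.
  apply: step_op_le => // i j pj0.
  by rewrite /a /block_average pj0 invr0 mulr0.
have opD : \int[P]_x (kernel_op P D f x ^+ 2) <= M * eps.
  apply: le_trans (kernel_op_hilbert_schmidt bD f1) _.
  apply: (@le_trans _ _ (\int[PP]_z (M * `|D z|))).
    apply: le_Rintegral => //.
    - exact: bounded_measurable_integrable_sqr.
    - apply: bounded_measurable_integrable; apply: bounded_measurableM.
        exact: bounded_measurable_cst.
      exact: bounded_measurable_norm.
    - move=> z _; rewrite -[leLHS]real_normK ?num_real // expr2 ler_wpM2r //.
      have K0 : 0 <= K z := dnn_ge0 K_dnn z.
      have H0 : 0 <= H z by exact: a0.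
      have := KM' z; have := le_trans (ler_norm _) (HM z).
      by rewrite ler_norml /D => ? ?; lra.
  rewrite Rintegral_scale; last exact: bounded_measurable_norm.
  exact: ler_wpM2l.
have iH := bounded_measurable_integrable_sqr P (bounded_measurable_kernel_op bH f1).
have iD := bounded_measurable_integrable_sqr P (bounded_measurable_kernel_op bD f1).
have sc (c : R) (g : T -> R) : P.-integrable setT (EFin \o g) ->
    P.-integrable setT (EFin \o (fun x => c * g x)).
  by move=> gi; apply: integrable_mul_bounded => //; exact: bounded_measurable_cst.
have iHc := sc (1 + eta) _ iH; have iDc := sc (1 + eta^-1) _ iD.
apply: (@le_trans _ _ (\int[P]_x ((1 + eta) * kernel_op P H f x ^+ 2 +
    (1 + eta^-1) * kernel_op P D f x ^+ 2))).
  apply: le_Rintegral => //.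
  - by apply: bounded_measurable_integrable_sqr; exact: bounded_measurable_kernel_op.
  - exact: (integrableD measurableT iHc iDc).
  - move=> x _; rewrite (kernel_opD x bH bK f1) -/D.
    set h := kernel_op P H f x; set g := kernel_op P D f x.
    rewrite -subr_ge0.
    rewrite (_ : _ - _ = (eta * h - g) ^+ 2 / eta); last by field; rewrite gt_eqF.
    by rewrite divr_ge0 ?sqr_ge0 // ltW.
rewrite RintegralD // !RintegralZl //.
apply: (@le_trans _ _ ((1 + eta) * r ^+ 2 + (1 + eta^-1) * (M * eps))).
  by apply: lerD; apply: ler_wpM2l => //; [rewrite addr_ge0 // ltW|rewrite ltW].
have -> : r ^+ 2 + e' = (1 + eta) * r ^+ 2 + eta.
  by rewrite /eta; field; rewrite gt_eqF.
by rewrite lerD2l mulrA mulrC.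
Qed.

(** A radius strictly between the D-th root of the right-hand side and the
    operator norm would bound the operator norm. *)
Lemma kernel_opnorm_pow_le (F : simple_graph) :
  fin_sidorenko R F -> (0 < edge_count F)%N ->
  (vertex_count F <= edge_count F)%N ->
  kernel_opnorm P K ^+ ((edge_count F).*2 - vertex_count F) <=
  hom_density P F K * kernel_norm1 P K ^+ (edge_count F - vertex_count F).
Proof.
move=> Fgood e_gt0 le_ve; set D := (_ - _)%N; set B := _ * _.
set rho := kernel_opnorm P K.
have D_gt0 : (0 < D)%N.
  by rewrite subn_gt0 -addnn (leq_ltn_trans le_ve) // -ltn_subLR // subnn.
have B0 : 0 <= B by rewrite mulr_ge0 ?hom_density_ge0 // exprn_ge0 // kernel_norm1_ge0.
have rho0 : 0 <= rho := le_trans kernel_norm1_ge0 kernel_norm1_le_opnorm.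
rewrite leNgt; apply/negP => Brho.
pose r0 := B `^ (D%:R^-1).
have r00 : 0 <= r0 by exact: powR_ge0.
have r0D : r0 ^+ D = B.
  by rewrite -powR_mulrn // -powRrM mulVf ?powRr1 // pnatr_eq0 -lt0n.
have r0rho : r0 < rho by rewrite -(ltr_pXn2r D_gt0) ?nnegrE // r0D.
pose r := (r0 + rho) / 2.
have rr0 : r0 < r by rewrite /r; lra.
have rrho : r < rho by rewrite /r; lra.
have r_gt0 : 0 < r := le_lt_trans r00 rr0.
have BrD : B < r ^+ D by rewrite -r0D ltr_pXn2r // nnegrE // ltW.
move: rrho; apply/negP; rewrite -leNgt; apply: kernel_opnorm_le; first exact: ltW.
by move=> f; exact: (Rintegral_kernel_op_sqr_le Fgood).
Qed.

End OperatorNormBounds.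

Theorem corollary7p3 (R : realType) (F : simple_graph)
    (hE : (0 < edge_count F)%N) (hvE : (vertex_count F <= edge_count F)%N) :
  sidorenko_good R F <->
  (forall (d : measure_display) (T : measurableType d) (P : probability T R)
     (K : T * T -> R),
   standard_atomless P -> bounded_dnn_kernel P K -> nonzero_kernel P K ->
   kernel_opnorm P K ^ ((edge_count F).*2%:Z - (vertex_count F)%:Z)
     * kernel_norm1 P K ^ ((vertex_count F)%:Z - (edge_count F)%:Z)
   <= hom_density P F K).
Proof.
have le_v2e : (vertex_count F <= (edge_count F).*2)%N.
  by rewrite (leq_trans hvE) // -addnn leq_addr.
have expE (rho S : R) :
    rho ^ ((edge_count F).*2%:Z - (vertex_count F)%:Z)
      * S ^ ((vertex_count F)%:Z - (edge_count F)%:Z) =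
    rho ^+ ((edge_count F).*2 - vertex_count F)
      / S ^+ (edge_count F - vertex_count F).
  by rewrite -[(vertex_count F)%:Z - _]opprB !subzn // -exprnN.
have S_gt0 d (T : measurableType d) (P : probability T R) (K : T * T -> R) :
    bounded_dnn_kernel P K -> nonzero_kernel P K -> 0 < kernel_norm1 P K.
  move=> K_dnn K_nz; rewrite lt_def (kernel_norm1_ge0 K_dnn) andbT.
  by apply/eqP => /(kernel_norm1_eq0P K_dnn).
split=> [Fgood|h] d T P K sP K_dnn.
  move=> K_nz; rewrite expE ler_pdivrMr ?exprn_gt0 ?S_gt0 //.
  exact: (kernel_opnorm_pow_le K_dnn (sidorenko_good_fin Fgood)).
have [S0|S_neq0] := eqVneq (kernel_norm1 P K) 0.
  by rewrite S0 expr0n eqn0Ngt hE /= hom_density_ge0.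
have K_nz : nonzero_kernel P K.
  by move=> /(kernel_norm1_eq0P K_dnn) S0; rewrite S0 eqxx in S_neq0.
have S0 := S_gt0 _ _ _ _ K_dnn K_nz.
apply: le_trans (h d T P K sP K_dnn K_nz).
(* S^e = S^(2e - v) S^(v - e), and S is at most the operator norm *)
rewrite expE ler_pdivlMr ?exprn_gt0 // -exprD.
have -> : (edge_count F + (edge_count F - vertex_count F) =
           (edge_count F).*2 - vertex_count F)%N by rewrite -addnn addnBA.
have S_le := kernel_norm1_le_opnorm K_dnn.
by apply: lerXn2r; rewrite ?nnegrE // ltW // (lt_le_trans S0).
Qed.
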